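(* Consider the multi-environment structural causal model with interventions on $X$ described in the context, with acyclic graph $G$, intervention set $I\subseteq[d]$, and augmented model $\tilde M$. Let $$A(I)=\{j:\ j\in\mathtt{ch}(d+1),\ j\notin I,\ \mathtt{at}(j)\cap\mathtt{ch}(d+1)\cap I=\emptyset\},$$ $$S_\star=\mathtt{pa}(d+1)\cup A(I)\cup\bigcup_{j\in A(I)}\big(\mathtt{pa}(j)\setminus\{d+1\}\big).$$ Then $m^{(e,S_\star)}\equiv\bar m^{(S_\star)}=:m_\star$ for all $e\in\mathcal E$. Suppose further that the following nondegeneracy conditions hold for $\tilde M$: (a) for every $S\subseteq[d]$ containing a descendant of $Y$ (i.e. $d+1\in\bigcup_{j\in S}\mathtt{at}(j)$), if $E$ and $Y$ are not conditionally independent given $X_S$ under $\tilde M$, then there exist $e,e'\in\mathcal E$ with $(\mu^{(e)}\wedge\mu^{(e')})(\{m^{(e,S)}\ne m^{(e',S)}\})>0$; (b) $\tilde M$ is faithful: for all disjoint $A,B,C\subseteq[d+2]$, if $Z_A$ and $Z_B$ are conditionally independent given $Z_C$, then $A$ and $B$ are d-separated by $C$ in $\tilde G$. Then for any $S\subseteq[d]$ with $\bar\mu(\{m_\star\ne\bar m^{(S\cup S_\star)}\})>0$ there exist $e,e'\in\mathcal E$ such that $(\mu^{(e)}\wedge\mu^{(e')})(\{m^{(e,S)}\ne m^{(e',S)}\})>0$.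
   Context: Multi-environment SCM. $\mathcal E=\{0,\dots,|\mathcal E|-1\}$. For each $e\in\mathcal E$, $Z^{(e)}=(Z^{(e)}_1,\dots,Z^{(e)}_{d+1})=(X_1^{(e)},\dots,X_d^{(e)},Y^{(e)})$ is generated by $$X_j^{(e)}\leftarrow f_j^{(e)}(Z^{(e)}_{\mathtt{pa}(j)},U_j),\ j=1,\dots,d,\qquad Y^{(e)}\leftarrow f_{d+1}(X^{(e)}_{\mathtt{pa}(d+1)},U_{d+1}).$$ The exogenous variables $U_1,\dots,U_{d+1}$ are independent with joint law $\nu$; $\nu$, the parent sets $\mathtt{pa}(j)\subseteq[d+1]$ and $f_{d+1}$ are the same for all $e$, while $f_j^{(e)}$, $j\le d$, may vary with $e$. The directed graph $G$ on $[d+1]$ with edges $i\to j$ iff $i\in\mathtt{pa}(j)$ is acyclic. $\mathbb E|Y^{(e)}|^2<\infty$. $\mathtt{ch}(k)=\{j:k\in\mathtt{pa}(j)\}$; $\mathtt{at}(k)=\mathtt{pa}(k)\cup\bigcup_{j\in\mathtt{pa}(k)}\mathtt{at}(j)$ is the set of ancestors of $k$ (all with respect to $G$). The set of intervened variables is $I=\{j\in[d]:\exists e\in\mathcal E,\ f_j^{(e)}\ne f_j^{(0)}\}$. Augmented model $\tilde M$, on $Z=(Z_1,\dots,Z_{d+2})=(X_1,\dots,X_d,Y,E)$: $E\leftarrow U_{d+2}$ with $U_{d+2}\sim\mathrm{Uniform}(\mathcal E)$ independent of $(U_1,\dots,U_{d+1})\sim\nu$; $X_j\leftarrow f_j^{(0)}(Z_{\mathtt{pa}(j)},U_j)$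 for $j\in[d]\setminus I$; $X_j\leftarrow f_j^{(E)}(Z_{\mathtt{pa}(j)},U_j)$ for $j\in I$; $Y\leftarrow f_{d+1}(X_{\mathtt{pa}(d+1)},U_{d+1})$. Its graph $\tilde G$ on $[d+2]$ is $G$ together with edges $d+2\to j$ for $j\in I$. Notation. $\mu^{(e)}$ is the law of $(X^{(e)},Y^{(e)})$; $\bar\mu=\frac1{|\mathcal E|}\sum_e\mu^{(e)}$; $\mu^{(e)}_{x,S},\bar\mu_{x,S}$ are the marginals of $X_S$; $m^{(e,S)}(x)=\mathbb E[Y^{(e)}|X^{(e)}_S=x_S]$; $\rho_S^{(e)}=d\mu^{(e)}_{x,S}/d\bar\mu_{x,S}$; $\bar m^{(S)}=\frac1{|\mathcal E|}\sum_e\rho_S^{(e)}m^{(e,S)}$ (the conditional expectation of $Y$ given $X_S$ under $\bar\mu$). $\mu\wedge\nu$ has density the pointwise minimum of the densities of $\mu,\nu$ with respect to a common dominating measure. Identities $m^{(e,S)}\equiv h$ are understood $\mu^{(e)}$-a.s. *)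

(* Defs.v *)
From HB Require Import structures.
From mathcomp Require Import all_boot all_order all_algebra.
From mathcomp Require Import all_classical all_reals all_analysis.

Set Implicit Arguments.
Unset Strict Implicit.
Unset Printing Implicit Defensive.

Import Order.TTheory GRing.Theory Num.Theory.
Import numFieldNormedType.Exports.

Local Open Scope classical_set_scope.
Local Open Scope charge_scope.
Local Open Scope ring_scope.

Section graph.
Variables (n : nat) (pa : 'I_n -> {set 'I_n}).

Definition edge : rel 'I_n := [rel i j | i \in pa j].

Definition acyclic : Prop := forall c : seq 'I_n, cycle edge c -> c = [::].

Definition children (k : 'I_n) : {set 'I_n} := [set j | k \in pa j]%SET.

(* Least solution of at(k) = pa(k) \cup \bigcup_(j in pa(k)) at(j). *)
Inductive ancestor : 'I_n -> 'I_n -> Prop :=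
| ancestor_pa i k : i \in pa k -> ancestor i k
| ancestor_trans i j k : j \in pa k -> ancestor i j -> ancestor i k.

Definition ancestors (k : 'I_n) : {set 'I_n} := [set i | `[< ancestor i k >]]%SET.

Definition descendants (k : 'I_n) : {set 'I_n} := [set j | k \in ancestors j]%SET.

Definition linked : rel 'I_n := [rel i j | edge i j || edge j i].

(* The consecutive nodes a, b, c of a path block it at b, given C. *)
Definition blocks (C : {set 'I_n}) (a b c : 'I_n) : bool :=
  if edge a b && edge c b
  then (b \notin C) && [disjoint descendants b & C]
  else b \in C.

Definition dseparated (A B C : {set 'I_n}) : Prop :=
  forall x p, x \in A -> last x p \in B ->
    path linked x p -> uniq (x :: p) ->
    exists2 i, (i.+2 < size (x :: p))%N &
      blocks C (nth x (x :: p) i) (nth x (x :: p) i.+1) (nth x (x :: p) i.+2).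

End graph.

Section coordinates.
Variables (R : realType) (n : nat).

Definition coords (S : {set 'I_n}) (z : n.-tuple R) : #|S|.-tuple R :=
  [tuple tnth z (enum_val i) | i < #|S|].

Lemma measurable_coords (S : {set 'I_n}) : measurable_fun setT (coords S).
Proof.
apply/measurable_fun_tnthP => i.
rewrite (_ : _ \o _ = (@tnth n R)^~ (enum_val i)); first exact: measurable_tnth.
by apply/funext => z /=; rewrite tnth_mktuple.
Qed.

HB.instance Definition _ (S : {set 'I_n}) :=
  isMeasurableFun.Build _ _ _ _ (coords S) (@measurable_coords S).

End coordinates.

Section conditioning.
Variables (R : realType) (n : nat) (mu : probability (n.-tuple R) R).

(* g is a version of x |-> E[V | Z_S = x] for Z of law mu. *)
Definition is_cond_exp (V : n.-tuple R -> R) (S : {set 'I_n})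
    (g : #|S|.-tuple R -> R) : Prop :=
  [/\ measurable_fun setT g,
      mu.-integrable setT (fun z => (g (coords S z))%:E) &
      forall B, measurable B ->
        (\int[mu]_(z in coords S @^-1` B) (g (coords S z))%:E =
         \int[mu]_(z in coords S @^-1` B) (V z)%:E)%E].

(* P(Z_A \in F, Z_B \in G | Z_C) = P(Z_A \in F | Z_C) P(Z_B \in G | Z_C) a.s. *)
Definition cond_indep (A B C : {set 'I_n}) : Prop :=
  forall F G, measurable F -> measurable G ->
    exists pF pG pFG : #|C|.-tuple R -> R,
      [/\ is_cond_exp \1_(coords A @^-1` F) pF,
          is_cond_exp \1_(coords B @^-1` G) pG,
          is_cond_exp \1_(coords A @^-1` F `&` coords B @^-1` G) pFG &
          {ae mu, forall z, pFG (coords C z) = pF (coords C z) * pG (coords C z)}].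

End conditioning.

Definition env (k : nat) : Type := 'I_k.+1.

HB.instance Definition _ k := Finite.on (env k).
HB.instance Definition _ k := isPointed.Build (env k) (ord0 : 'I_k.+1).
HB.instance Definition _ k := @isMeasurable.Build default_measure_display
  (env k) discrete_measurable discrete_measurable0
  discrete_measurableC discrete_measurableU.

Section mixture.
Local Open Scope ereal_scope.
Context d (T : measurableType d) (R : realType) (k : nat).
Variable mu : env k -> probability T R.

Definition mixture (A : set T) : \bar R := (k.+1%:R^-1)%:E * \sum_e mu e A.

Let mixture0 : mixture set0 = 0.
Proof. by rewrite /mixture big1 ?mule0// => e _; rewrite measure0. Qed.

Let mixture_ge0 A : 0 <= mixture A.
Proof. by apply: mule_ge0; [rewrite lee_fin|apply: sume_ge0]. Qed.

Let mixture_sigma_additive : semi_sigma_additive mixture.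
Proof.
have rge0 : (0 <= k.+1%:R^-1 :> R)%R by [].
rewrite (_ : mixture = mscale (NngNum rge0) (msum (fun i => mu (inord i)) k.+1)).
  exact: measure_semi_sigma_additive.
apply/funext => A; rewrite /mixture /mscale /msum/=; congr (_ * _).
by apply: eq_bigr => i _; rewrite inord_val.
Qed.

HB.instance Definition _ := isMeasure.Build _ _ _ mixture
  mixture0 mixture_ge0 mixture_sigma_additive.

Let mixture_setT : mixture setT = 1.
Proof.
rewrite /mixture (eq_bigr (fun=> 1)) => [|e _]; last exact: probability_setT.
rewrite sumEFin sumr_const -EFinM [#|_|]card_ord.
by rewrite -[X in (_ * X)%R]/(k.+1%:R) mulVf// pnatr_eq0.
Qed.

HB.instance Definition _ := Measure_isProbability.Build _ _ _ mixture mixture_setT.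

End mixture.

(* mu /\ nu, from densities with respect to lam, which must dominate both. *)
Definition min_measure d (T : measurableType d) (R : realType)
    (lam mu nu : probability T R) (A : set T) : \bar R :=
  (\int[lam]_(z in A) Order.min ('d (charge_of_finite_measure mu) '/d lam z)
                                ('d (charge_of_finite_measure nu) '/d lam z))%E.

(* There are k.+1 environments 0, ..., k. Nodes are numbered from 0: node j < d is the
   covariate X_(j+1) and node d is Y. *)
Definition ynode {d : nat} : 'I_d.+1 := ord_max.

Record menv_scm (R : realType) (d k : nat) := MEnvSCM {
  pa : 'I_d.+1 -> {set 'I_d.+1};
  pa_acyclic : acyclic pa;

  (* Exogenous variables exo j = U_(j+1); nu is their joint law under prob. *)
  exo_disp : 'I_d.+1 -> measure_display;
  exo_type : forall j, measurableType (exo_disp j);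
  omega_disp : measure_display;
  omega : measurableType omega_disp;
  prob : probability omega R;
  exo : forall j, {RV prob >-> exo_type j};
  exo_indep : forall (J : {set 'I_d.+1}) (A : forall j, set (exo_type j)),
    (forall j, measurable (A j)) ->
    prob (\bigcap_(j in [set` J]) (exo j @^-1` A j)) =
    (\prod_(j in J) prob (exo j @^-1` A j))%E;

  fstr : env k -> forall j, {mfun (#|pa j|.-tuple R * exo_type j)%type >-> R};
  fstr_y : forall e, fstr e ynode = fstr ord0 ynode :> (_ -> _);

  endo : env k -> {RV prob >-> (d.+1).-tuple R};
  endo_eq : forall e j w,
    tnth (endo e w) j = fstr e j (coords (pa j) (endo e w), exo j w);
  endo_y_L2 : forall e,
    ('E_prob[fun w => (`|tnth (endo e w) ynode| ^+ 2 : R)%R] < +oo)%E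
}.

Section model.
Variables (R : realType) (d k : nat) (M : menv_scm R d k).

Definition intervened : {set 'I_d.+1} :=
  [set j | (j != ynode) &&
     `[< exists e, fstr M e j <> fstr M ord0 j :> (_ -> _) >]]%SET.

Definition law (e : env k) : probability ((d.+1).-tuple R) R :=
  distribution (prob M) (endo M e).

Definition mean_law : probability ((d.+1).-tuple R) R := mixture law.

Definition law_meet (e e' : env k) : set ((d.+1).-tuple R) -> \bar R :=
  min_measure mean_law (law e) (law e').

(* d mu^(e)_(x,S) / d mubar_(x,S) *)
Definition env_density (e : env k) (S : {set 'I_d.+1}) : #|S|.-tuple R -> \bar R :=
  'd (charge_of_finite_measure (distribution (law e) (coords S)))
  '/d (distribution mean_law (coords S)).

(* A choice of versions, as functions of x_S, of the m^(e,S), for S not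
   containing Y. *)
Definition regression_versions
    (m : env k -> forall S : {set 'I_d.+1}, #|S|.-tuple R -> R) : Prop :=
  forall e (S : {set 'I_d.+1}), ynode \notin S ->
    is_cond_exp (law e) (fun z => tnth z ynode) (m e S).

Definition mean_regression
    (m : env k -> forall S : {set 'I_d.+1}, #|S|.-tuple R -> R)
    (S : {set 'I_d.+1}) (x : #|S|.-tuple R) : R :=
  k.+1%:R^-1 * \sum_e fine (env_density e x) * m e S x.

Definition stable_children : {set 'I_d.+1} :=
  [set j in children (pa M) ynode | (j \notin intervened) &&
     [disjoint ancestors (pa M) j & children (pa M) ynode :&: intervened]]%SET.

Definition Sstar : {set 'I_d.+1} :=
  (pa M ynode :|: stable_children :|:
     \bigcup_(j in stable_children) (pa M j :\ ynode))%SET.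

(* Augmented model: E is the last node d.+1, after X_1, ..., X_d and Y. *)

Definition enode : 'I_d.+2 := ord_max.

Definition aug_node (j : 'I_d.+1) : 'I_d.+2 := lift ord_max j.

Definition aug_set (S : {set 'I_d.+1}) : {set 'I_d.+2} := (aug_node @: S)%SET.

Definition aug_pa (i : 'I_d.+2) : {set 'I_d.+2} :=
  if unlift ord_max i is Some j
  then (aug_set (pa M j) :|: [set l | (l == enode) && (j \in intervened)])%SET
  else finset.set0.

(* The second component of the sample space is U_(d+2). *)
Definition aug_prob : probability (omega M * env k)%type R :=
  (prob M \x mixture (fun e : env k => \d_e))%E.

Definition aug_endo_part (z : (d.+2).-tuple R) : (d.+1).-tuple R :=
  [tuple tnth z (aug_node j) | j < d.+1].

(* Labels e of environments enter the tuple as the real numbers e%:R. *)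
Definition aug_solution (Z : {RV aug_prob >-> (d.+2).-tuple R}) : Prop :=
  forall w (e : env k),
    tnth (Z (w, e)) enode = (nat_of_ord e)%:R /\
    forall j : 'I_d.+1, tnth (Z (w, e)) (aug_node j) =
      fstr M (if j \in intervened then e else ord0) j
        (coords (pa M j) (aug_endo_part (Z (w, e))), exo M j w).

Definition aug_law (Z : {RV aug_prob >-> (d.+2).-tuple R}) :
  probability ((d.+2).-tuple R) R := distribution aug_prob Z.

Definition heterogeneous
    (m : env k -> forall S : {set 'I_d.+1}, #|S|.-tuple R -> R)
    (S : {set 'I_d.+1}) : Prop :=
  exists e e' : env k,
    (0 < law_meet e e' [set z | m e S (coords S z) <> m e' S (coords S z)])%E.

Definition aug_nondegenerate
    (m : env k -> forall S : {set 'I_d.+1}, #|S|.-tuple R -> R)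
    (Z : {RV aug_prob >-> (d.+2).-tuple R}) : Prop :=
  forall S : {set 'I_d.+1}, ynode \notin S ->
    ynode \in (\bigcup_(j in S) ancestors (pa M) j)%SET ->
    ~ cond_indep (aug_law Z) [set enode]%SET [set aug_node ynode]%SET
        (aug_set S) ->
    heterogeneous m S.

Definition aug_faithful (Z : {RV aug_prob >-> (d.+2).-tuple R}) : Prop :=
  forall A B C : {set 'I_d.+2},
    [disjoint A & B]%B -> [disjoint A & C]%B -> [disjoint B & C]%B ->
    cond_indep (aug_law Z) A B C -> dseparated aug_pa A B C.

End model.

Arguments mean_regression {R d k} M m S x.

(* Main.v *)
Require Import Defs.
From HB Require Import structures.
From mathcomp Require Import all_boot all_order all_algebra.
From mathcomp Require Import all_classical all_reals all_analysis.
From mathcomp Require Import measurable_realfun.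

(** Let A be the set A(I) of stable children of Y. Split the exogenous randomness
    of the pooled model (a uniform environment E, and given E = e the e-th SCM)
    into two independent sources: the noise of Y and of A on one side, E and all
    the remaining noise on the other. Reveal X_(S_star) in topological order: a
    node of A is a function of the first source and of the nodes already revealed,
    any other node is a function of the second source and of the nodes already
    revealed. Hence the two sources remain independent given X_(S_star). If W
    contains S_star and the only children of Y in W, or with a descendant in W, are
    those of A, then X_W and E are functions of X_(S_star) and of the second source,
    while Y is a function of X_(S_star) and of the first; so one and the same
    function of X_(S_star) is a version of E[Y | X_W] in every environment.

    W = S_star gives the first claim. For the second, a non-heterogeneous S either
    contains no descendant of Y, or, by (a) and faithfulness, d-separates E from Y,
    so that no collider E -> c <- Y has c or a descendant of c in S. In both cases
    W = S \cup S_star has the property above. *)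

Set Implicit Arguments.
Unset Strict Implicit.
Unset Printing Implicit Defensive.

Import Order.TTheory GRing.Theory Num.Theory.
Import numFieldNormedType.Exports.

Local Open Scope classical_set_scope.
Local Open Scope ring_scope.

(** * Conditional expectation and conditional independence *)

Section density.
Local Open Scope ereal_scope.
Context d (T : measurableType d) (R : realType).
Variable P : {finite_measure set T -> \bar R}.

(** Integrability of [f] makes the measure with density [f] finite. In this form, equality of
    integrals can be proved by uniqueness of measures. *)
Lemma density_measure_ex (f : T -> \bar R) :
  (forall x, 0 <= f x) -> P.-integrable setT f ->
  exists nu : {finite_measure set T -> \bar R},
    [/\ forall A, nu A = \int[P]_(x in A) f x, nu `<< P &
        forall g : T -> \bar R, (forall x, 0 <= g x) -> measurable_fun setT g ->
          \int[nu]_x g x = \int[P]_x (g x * f x)].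
Proof.
move=> f0 fi; have mf := measurable_int _ fi.
pose m A := \int[P]_(x in A) f x.
have m0 : m set0 = 0 by rewrite /m integral_set0.
have mge A : 0 <= m A by exact: integral_ge0.
have msa : semi_sigma_additive m by exact: semi_sigma_additive_nng_induced.
pose mixin := isMeasure.Build _ _ _ m m0 mge msa.
have fin : fin_num_fun m.
  move=> A mA; apply: integrable_fin_num => //.
  exact: integrableS fi.
pose M : {measure set T -> \bar R} := HB.pack m mixin.
pose fmixin := @Measure_isFinite.Build _ _ _ M fin.
pose nu : {finite_measure set T -> \bar R} := HB.pack m mixin fmixin.
have nuP : nu `<< P.
  apply/null_content_dominatesP => A mA PA0.
  rewrite /= /m; apply: null_set_integral => //.
  exact: measurable_funTS.
exists nu; split => // g g0 mg.
(* Change of variables is known for the Radon-Nikodym derivative [r] of [nu]; it agrees with [f]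
   a.e., both having the same integral over every measurable set. *)
pose r := Radon_Nikodym_SigmaFinite.f nu P.
have ri : P.-integrable setT r by exact: Radon_Nikodym_SigmaFinite.f_integrable.
rewrite -(Radon_Nikodym_SigmaFinite.change_of_variables nuP)//.
apply: ae_eq_integral => //.
- by apply: emeasurable_funM => //; exact: measurable_int ri.
- exact: emeasurable_funM.
- apply: ae_eqe_mul2l; apply: integral_ae_eq => // E _ mE.
  by rewrite -Radon_Nikodym_SigmaFinite.f_integral.
Qed.
End density.

(** * Conditional expectation given a map *)

Section conditional_expectation.
Local Open Scope ereal_scope.
Context d d' (T : measurableType d) (T' : measurableType d') (R : realType).
Variables (P : {finite_measure set T -> \bar R}) (p : T -> T').
Hypothesis mp : measurable_fun setT p.

Lemma finite_pushforward_ex (nu : {finite_measure set T -> \bar R}) :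
  exists rho : {finite_measure set T' -> \bar R},
    (forall B, rho B = nu (p @^-1` B)) /\
    (forall g : T' -> \bar R, (forall x, 0 <= g x) -> measurable_fun setT g ->
      \int[rho]_x g x = \int[nu]_x g (p x)).
Proof.
pose pushM := (pushforward nu p : {measure set T' -> \bar R}).
pose M := pushM mp.
have fin : fin_num_fun M.
  move=> A mA; apply: fin_num_measure.
  by rewrite -[X in measurable X]setTI; exact: mp.
pose fmixin := @Measure_isFinite.Build _ _ _ M fin.
pose rho : {finite_measure set T' -> \bar R} := HB.pack (M : set T' -> \bar R)
  (Measure.on M) fmixin.
exists rho; split => // g g0 mg.
by rewrite ge0_integral_pushforward// preimage_setT.
Qed.

(** Both sides integrate [g] against a pushforward under [p], of the measure with density [f1] or
    [f2]; the hypothesis on preimages says that these pushforwards coincide. *)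
Lemma integral_comp_eq (f1 f2 : T -> \bar R) (g : T' -> \bar R) :
  (forall x, 0 <= f1 x) -> P.-integrable setT f1 ->
  (forall x, 0 <= f2 x) -> P.-integrable setT f2 ->
  (forall B, measurable B ->
    \int[P]_(x in p @^-1` B) f1 x = \int[P]_(x in p @^-1` B) f2 x) ->
  (forall x, 0 <= g x) -> measurable_fun setT g ->
  \int[P]_x (g (p x) * f1 x) = \int[P]_x (g (p x) * f2 x).
Proof.
move=> f10 if1 f20 if2 f12 g0 mg.
have [nu1 [nu1E _ nu1I]] := density_measure_ex f10 if1.
have [nu2 [nu2E _ nu2I]] := density_measure_ex f20 if2.
have [rho1 [rho1E rho1I]] := finite_pushforward_ex nu1.
have [rho2 [rho2E rho2I]] := finite_pushforward_ex nu2.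
have mgp : measurable_fun setT (g \o p) by exact: measurableT_comp.
rewrite -(nu1I (g \o p))//= -(nu2I (g \o p))//= -rho1I// -rho2I//.
apply: eq_measure_integral => B mB _.
suff : rho1 B = rho2 B by [].
by rewrite rho1E rho2E nu1E nu2E f12.
Qed.

(** Push forward under [p] both [P] and the measure with density [f]: the Radon-Nikodym derivative
    of the second image with respect to the first lives on [T'], hence is the conditional
    expectation given [p]. *)
Lemma cond_exp_ex (f : T -> \bar R) :
  (forall x, 0 <= f x) -> P.-integrable setT f ->
  exists g : T' -> \bar R,
    [/\ forall x, 0 <= g x, forall x, g x \is a fin_num, measurable_fun setT g,
        P.-integrable setT (g \o p) &
        forall B, measurable B ->
          \int[P]_(x in p @^-1` B) f x = \int[P]_(x in p @^-1` B) g (p x)].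
Proof.
move=> f0 fi.
have [nu [nuE nuP _]] := density_measure_ex f0 fi.
have [rho [rhoE _]] := finite_pushforward_ex nu.
have [Q [QE QI]] := finite_pushforward_ex P.
have rQ : rho `<< Q.
  apply/null_content_dominatesP => A mA QA0.
  have mpA : measurable (p @^-1` A).
    by rewrite -[X in measurable X]setTI; exact: mp.
  have nu0 : P (p @^-1` A) = 0 -> nu (p @^-1` A) = 0.
    by move/null_content_dominatesP : nuP; exact.
  suff : rho A = 0 by [].
  by rewrite rhoE nu0// -QE; exact: QA0.
pose g := Radon_Nikodym_SigmaFinite.f rho Q.
have gi : Q.-integrable setT g by exact: Radon_Nikodym_SigmaFinite.f_integrable.
have g0 x : 0 <= g x by exact: Radon_Nikodym_SigmaFinite.f_ge0.
have mg : measurable_fun setT g := measurable_int _ gi.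
have gE B : measurable B ->
    \int[P]_(x in p @^-1` B) f x = \int[P]_(x in p @^-1` B) g (p x).
  move=> mB; rewrite -nuE -rhoE (Radon_Nikodym_SigmaFinite.f_integral rQ)//.
  rewrite integral_mkcond QI//; last 2 first.
    by move=> x; exact: erestrict_ge0.
    by apply/(measurable_restrictT g mB); exact: measurable_funTS.
  by rewrite [RHS]integral_mkcond; apply: eq_integral.
exists g; split => //.
- by move=> x; exact: Radon_Nikodym_SigmaFinite.f_fin_num.
- apply/integrableP; split; first exact: measurableT_comp.
  under eq_integral do rewrite /= gee0_abs//.
  have := gE setT measurableT; rewrite preimage_setT => <-.
  case/integrableP : fi => mf; apply: le_lt_trans.
  by apply: ge0_le_integral => //= [|x _]; [exact: measurableT_comp|rewrite gee0_abs].
Qed.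

End conditional_expectation.

(** * Measurability with respect to generated sigma-algebras *)

Lemma g_sigma_algebra_min d (T : measurableType d) (G K : set (set T)) :
  G `<=` <<s K >> -> <<s G >> `<=` <<s K >>.
Proof. by move=> GK; apply: smallest_sub => //; exact: smallest_sigma_algebra. Qed.

Lemma g_sigma_algebra_measurable d (T : measurableType d) (G : set (set T)) :
  G `<=` measurable -> <<s G >> `<=` measurable.
Proof. by apply: smallest_sub; exact: sigma_algebra_measurable. Qed.

Lemma measurable_fun_g_sigma d d' (T : measurableType d) (T' : measurableType d')
    (G K : set (set T)) (f : T -> T') : G `<=` <<s K >> ->
  measurable_fun setT (f : g_sigma_algebraType G -> T') ->
  measurable_fun setT (f : g_sigma_algebraType K -> T').
Proof.
move=> GK mf _ A mA; rewrite setTI; apply: (g_sigma_algebra_min GK).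
by have := mf measurableT A mA; rewrite setTI.
Qed.

(** Makes conditioning on a generated sigma-algebra a case of conditioning on a map, here the
    identity into the coarser measurable space. *)
Lemma measurable_id_g_sigma d (T : measurableType d) (G : set (set T)) :
  G `<=` measurable -> measurable_fun setT (id : T -> g_sigma_algebraType G).
Proof. by move=> Gm _ A mA; rewrite setTI; exact: g_sigma_algebra_measurable mA. Qed.

(** * Conditional independence of two sources under a growing history *)

Section cindep.
Local Open Scope ereal_scope.
Context d (T : measurableType d) (R : realType) (P : probability T R).
Implicit Types (F A B C : set T) (G H K M : set (set T)).

(* [h] is a version of P(F | G2, H). The event F ranges over [G1] only, which is
   a generating pi-system in all uses. *)
Definition cindep G1 G2 H : Prop := forall F, G1 F ->
  exists h : T -> \bar R,
    [/\ forall x, 0 <= h x,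
        measurable_fun setT (h : g_sigma_algebraType H -> \bar R),
        P.-integrable setT h &
        forall A, <<s G2 `|` H >> A -> P (F `&` A) = \int[P]_(x in A) h x].

Lemma integrable_indicator A : measurable A ->
  P.-integrable setT (fun x => (\1_A x)%:E : \bar R).
Proof. by move=> mA; exact: integrable_indic. Qed.

Lemma integral_mulindic A (f : T -> \bar R) :
  \int[P]_(x in A) f x = \int[P]_x (f x * (\1_A x)%:E).
Proof. by rewrite integral_mkcond epatch_indic. Qed.

Lemma integral_g_sigma_eq K (f1 f2 g : T -> \bar R) : K `<=` measurable ->
  (forall x, 0 <= f1 x) -> P.-integrable setT f1 ->
  (forall x, 0 <= f2 x) -> P.-integrable setT f2 ->
  (forall B, <<s K >> B -> \int[P]_(x in B) f1 x = \int[P]_(x in B) f2 x) ->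
  (forall x, 0 <= g x) ->
  measurable_fun setT (g : g_sigma_algebraType K -> \bar R) ->
  \int[P]_x (g x * f1 x) = \int[P]_x (g x * f2 x).
Proof.
move=> Km f10 if1 f20 if2 f12 g0 mg.
exact: (integral_comp_eq (measurable_id_g_sigma Km) f10 if1 f20 if2 f12 g0 mg).
Qed.

(** The two integrals are finite measures in [B], so it is enough to compare them on the pi-system
    of sets [F] intersected with [C], for [F] in [G1] and [C] generated by [H]. There the indicator
    of [F] is traded for its conditional probability [h], and the weight left on [f] and on [g] is
    [H]-measurable. *)
Lemma cindep_integral G1 G2 H (f g : T -> \bar R) :
  G1 `<=` measurable -> G2 `<=` measurable -> H `<=` measurable ->
  setI_closed G1 -> G1 setT -> cindep G1 G2 H ->
  (forall x, 0 <= f x) -> P.-integrable setT f ->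
  measurable_fun setT (f : g_sigma_algebraType (G2 `|` H) -> \bar R) ->
  (forall x, 0 <= g x) -> P.-integrable setT g ->
  measurable_fun setT (g : g_sigma_algebraType H -> \bar R) ->
  (forall C, <<s H >> C -> \int[P]_(x in C) f x = \int[P]_(x in C) g x) ->
  forall B, <<s G1 `|` H >> B -> \int[P]_(x in B) f x = \int[P]_(x in B) g x.
Proof.
move=> G1m G2m Hm G1I G1T ci f0 fi mf g0 gi mg fg B sB.
have G2Hm : G2 `|` H `<=` measurable by rewrite subUset.
have [nuf [nufE _ _]] := density_measure_ex f0 fi.
have [nug [nugE _ _]] := density_measure_ex g0 gi.
suff : nuf B = nug B by rewrite nufE nugE.
pose rect := [set F `&` C | F in G1 & C in <<s H >>].
have HT : <<s H >> setT by exact: (@measurableT _ (g_sigma_algebraType H)).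
have rectm : rect `<=` measurable.
  move=> _ [F GF [C HC <-]]; apply: measurableI; first exact: G1m.
  exact: g_sigma_algebra_measurable HC.
have rectI : setI_closed rect.
  move=> _ _ [F GF [C HC <-]] [F' GF' [C' HC' <-]].
  exists (F `&` F'); first exact: G1I.
  exists (C `&` C'); last by rewrite setIACA.
  exact: (@measurableI _ (g_sigma_algebraType H)).
have rectT : rect setT by exists setT => //; exists setT => //; rewrite setTI.
have : <<s rect >> B.
  apply: g_sigma_algebra_min sB => A [GA|HA]; apply: sub_sigma_algebra.
    by exists A => //; exists setT => //; rewrite setIT.
  by exists setT => //; exists A; [exact: sub_sigma_algebra|rewrite setTI].
apply: (@g_sigma_algebra_measure_unique _ _ _ rect rectm (fun=> setT)) => //.
- by rewrite bigcup_const.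
- move=> _ [F GF [C HC <-]].
  have [h [h0 mh hi hE]] := ci F GF.
  have mF := G1m F GF.
  have mC := g_sigma_algebra_measurable Hm HC.
  have i0 A x : 0 <= (\1_A x)%:E :> \bar R by rewrite lee_fin.
  have m1C : measurable_fun setT
      ((fun x => (\1_C x)%:E) : g_sigma_algebraType H -> \bar R).
    by apply/measurable_EFinP; exact: measurable_indic.
  have HG : H `<=` <<s G2 `|` H >> by move=> A HA; apply: sub_sigma_algebra; right.
  have hE' A : <<s G2 `|` H >> A ->
      \int[P]_(x in A) (\1_F x)%:E = \int[P]_(x in A) h x.
    move=> sA; rewrite -hE// integral_indic//.
    exact: (g_sigma_algebra_measurable G2Hm).
  have ind u : \int[P]_(x in F `&` C) u x =
      \int[P]_x ((u x * (\1_C x)%:E) * (\1_F x)%:E).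
    rewrite integral_mulindic; apply: eq_integral => x _.
    by rewrite indicI /= EFinM (muleC (\1_F x)%:E) muleA.
  suff: \int[P]_(x in F `&` C) f x = \int[P]_(x in F `&` C) g x.
    by rewrite -nufE -nugE.
  (* The indicator of [F] becomes [h] on both sides: here against the factor [f 1_C], measurable for
     [G2] and [H], and next against [g 1_C], measurable for [H] alone. *)
  rewrite !ind (integral_g_sigma_eq G2Hm (i0 F) _ h0 hi)//; first last.
  + apply: emeasurable_funM => //; exact: measurable_fun_g_sigma m1C.
  + by move=> x; rewrite mule_ge0.
  + exact: integrable_indicator.
  rewrite [RHS](integral_g_sigma_eq Hm (i0 F) _ h0 hi)//; first last.
  + exact: emeasurable_funM.
  + by move=> x; rewrite mule_ge0.
  + by move=> A HA; apply: hE'; exact: g_sigma_algebra_min HA.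
  + exact: integrable_indicator.
  have sw u : \int[P]_x (u x * (\1_C x)%:E * h x) =
      \int[P]_x ((\1_C x)%:E * h x * u x).
    by apply: eq_integral => x _; rewrite -muleA muleC.
  (* The factor [1_C h] is [H]-measurable, so the hypothesis on [f] and [g] applies. *)
  rewrite !sw; apply: (integral_g_sigma_eq Hm f0 fi g0 gi) => //.
  + by move=> x; rewrite mule_ge0.
  + exact: emeasurable_funM.
- by move=> n; rewrite -ge0_fin_numE//; exact: fin_num_measure.
Qed.

(** For [F] in [G2], a version of P(F | H) is also one of P(F | G1, H), by [cindep_integral] applied
    to the indicator of [F]. *)
Lemma cindep_sym G1 G2 H :
  G1 `<=` measurable -> G2 `<=` measurable -> H `<=` measurable ->
  setI_closed G1 -> G1 setT -> cindep G1 G2 H -> cindep G2 G1 H.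
Proof.
move=> G1m G2m Hm G1I G1T ci F GF.
have mF := G2m F GF.
have i0 x : 0 <= (\1_F x)%:E :> \bar R by rewrite lee_fin.
have i1 := integrable_indicator mF.
have [g [g0 _ mg gi gE]] := cond_exp_ex (measurable_id_g_sigma Hm) i0 i1.
exists g; split => // A sA.
rewrite -(@cindep_integral G1 G2 H (fun x => (\1_F x)%:E) g)//.
- rewrite integral_indic//; apply: (@g_sigma_algebra_measurable _ _ (G1 `|` H)) sA.
  by rewrite subUset.
- apply/measurable_EFinP; apply: measurable_indic.
  by apply: sub_sigma_algebra; left.
Qed.

(** Events already determined by [G2] and [H] do not enlarge the conditioning, so the same [h]
    serves. *)
Lemma cindep_absorb G1 G2 H M : M `<=` <<s G2 `|` H >> ->
  cindep G1 G2 H -> cindep G1 G2 (H `|` M).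
Proof.
move=> MG ci F /ci[h [h0 mh hi hE]]; exists h; split => //.
  apply: measurable_fun_g_sigma mh => A HA.
  by apply: sub_sigma_algebra; left.
move=> A sA; apply: hE; apply: g_sigma_algebra_min sA => B [GB|[HB|MB]].
- by apply: sub_sigma_algebra; left.
- by apply: sub_sigma_algebra; right.
- exact: MG.
Qed.

(** One round of revelation: each source announces events computed from itself and the history [H].
    Those of [G1] are absorbed after exchanging the sources, those of [G2] directly. *)
Lemma cindep_step G1 G2 H M1 M2 :
  G1 `<=` measurable -> G2 `<=` measurable -> H `<=` measurable ->
  setI_closed G1 -> G1 setT -> setI_closed G2 -> G2 setT ->
  M1 `<=` <<s G1 `|` H >> -> M2 `<=` <<s G2 `|` H >> ->
  cindep G1 G2 H -> cindep G1 G2 (H `|` M1 `|` M2).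
Proof.
move=> G1m G2m Hm G1I G1T G2I G2T M1G M2G ci.
have M1m : M1 `<=` measurable.
  apply: (subset_trans M1G); apply: g_sigma_algebra_measurable.
  by rewrite subUset.
have HM1m : H `|` M1 `<=` measurable by rewrite subUset.
apply: cindep_absorb.
  apply: (subset_trans M2G); apply: g_sigma_algebra_min => A [GA|HA].
    by apply: sub_sigma_algebra; left.
  by apply: sub_sigma_algebra; right; left.
apply: cindep_sym => //; apply: cindep_absorb => //.
exact: cindep_sym.
Qed.

(** Starting point of the revelation, with empty history. The constant [P F] is the version;
    independence on the pi-system [G2] extends to the sigma-algebra it generates. *)
Lemma cindep_indep G1 G2 :
  G1 `<=` measurable -> G2 `<=` measurable -> setI_closed G2 -> G2 setT ->
  (forall F A, G1 F -> G2 A -> P (F `&` A) = P F * P A) ->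
  cindep G1 G2 set0.
Proof.
move=> G1m G2m G2I G2T ind F GF; have mF := G1m F GF.
have h0 (x : T) : 0 <= P F by exact: measure_ge0.
have hi : P.-integrable setT (fun=> P F).
  rewrite -(fineK (fin_num_measure P F mF)).
  exact: finite_measure_integrable_cst.
exists (fun=> P F); split => // A; rewrite setU0 => sA.
have [nu1 [nu1E _ _]] := density_measure_ex h0 hi.
have i0 x : 0 <= (\1_F x)%:E :> \bar R by rewrite lee_fin.
have [nu2 [nu2E _ _]] := density_measure_ex i0 (integrable_indicator mF).
have mA := g_sigma_algebra_measurable G2m sA.
suff : nu2 A = nu1 A by rewrite nu1E nu2E integral_indic.
move: sA; apply: (@g_sigma_algebra_measure_unique _ _ _ G2 G2m (fun=> setT)) => //.
- by rewrite bigcup_const.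
- move=> B GB; suff : nu2 B = nu1 B by [].
  have mB := G2m B GB.
  by rewrite nu1E nu2E integral_indic// integral_cst//; exact: ind.
- by move=> n; rewrite -ge0_fin_numE//; exact: fin_num_measure.
Qed.

End cindep.

(** * The pooled model *)

Section graph_lemmas.
Variables (n : nat) (pa : 'I_n -> {set 'I_n}).
Hypothesis pa_acyclic : acyclic pa.

Lemma ancestor_comp i j l : ancestor pa i j -> ancestor pa j l -> ancestor pa i l.
Proof.
move=> aij ajl; elim: ajl aij => {j l}[j l jl|j h l hl _ IH] aij.
  exact: ancestor_trans aij.
by apply: (ancestor_trans hl); exact: IH.
Qed.

Lemma ancestor_path i j : ancestor pa i j ->
  exists p, path (edge pa) i (rcons p j).
Proof.
elim=> {i j}[i j ij|i h j hj _ [p pp]]; first by exists [::]; rewrite /= andbT.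
by exists (rcons p h); rewrite rcons_path pp last_rcons.
Qed.

Lemma ancestor_irrefl i : ~ ancestor pa i i.
Proof. by move=> /ancestor_path[p pp]; have := pa_acyclic (c := i :: p) pp. Qed.

Lemma ancestorsE i j : (i \in ancestors pa j) <-> ancestor pa i j.
Proof. by rewrite inE; split => /asboolP. Qed.

(** Serves as a topological order: in an acyclic graph the ancestors of a parent are among those of
    its child, and the parent itself is missing from them. *)
Definition rank (j : 'I_n) : nat := #|ancestors pa j|.

Lemma rank_pa i j : i \in pa j -> (rank i < rank j)%N.
Proof.
move=> ij; apply: proper_card; apply/properP; split.
  apply/fintype.subsetP => h /ancestorsE hi; apply/ancestorsE.
  exact: ancestor_trans hi.
exists i; first by apply/ancestorsE; exact: ancestor_pa.
by apply/negP => /ancestorsE; exact: ancestor_irrefl.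
Qed.

Lemma rank_lt j : (rank j < n.+1)%N.
Proof. by rewrite ltnS (leq_trans (max_card _))// card_ord. Qed.

End graph_lemmas.

Section mixture_lemmas.
Local Open Scope ereal_scope.
Context d (T : measurableType d) (R : realType) (k : nat).
Variable mu : env k -> probability T R.

Lemma ge0_integral_mixture (A : set T) (f : T -> \bar R) :
  measurable A -> (forall x, 0 <= f x) -> measurable_fun A f ->
  \int[mixture mu]_(x in A) f x = (k.+1%:R^-1)%:E * \sum_e \int[mu e]_(x in A) f x.
Proof.
move=> mA f0 mf.
have rge0 : (0 <= k.+1%:R^-1 :> R)%R by [].
transitivity (\int[mscale (NngNum rge0) (msum (fun i => mu (inord i)) k.+1)]_(x in A) f x).
  apply: eq_measure_integral => B mB _; rewrite /= /mixture /mscale /msum /=.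
  by congr (_ * _); apply: eq_bigr => i _; rewrite inord_val.
rewrite ge0_integral_mscale//; congr (_ * _).
rewrite ge0_integral_measure_sum//.
by apply: eq_bigr => i _; rewrite inord_val.
Qed.

Lemma dominates_mixture e : mu e `<< mixture mu.
Proof.
apply/null_content_dominatesP => A mA.
rewrite /= /mixture => /eqP; rewrite mule_eq0 => /orP[|].
  by rewrite eqe invr_eq0 pnatr_eq0.
rewrite (bigD1 e)//= padde_eq0//; last by apply: sume_ge0.
by case/andP => /eqP.
Qed.

End mixture_lemmas.

(** * Sample space of the pooled model *)

Section joint.
Context (R : realType) (d k : nat) (M : menv_scm R d k).
Notation Om := (omega M * env k)%type.

Definition at_env (e : env k) (w : omega M) : Om := (w, e).

Lemma measurable_at_env e : measurable_fun setT (at_env e).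
Proof. exact: measurable_fun_pair. Qed.

HB.instance Definition _ e := isMeasurableFun.Build _ _ _ _ (at_env e)
  (@measurable_at_env e).

(** The environment is uniform and independent of the noise; the mixture form turns integrals into
    averages over environments. *)
Definition joint : probability Om R :=
  mixture (fun e => distribution (prob M) (at_env e)).

Definition joint_endo (p : Om) : d.+1.-tuple R := endo M p.2 p.1.

Lemma measurable_env_slice (D : set (env k)) : measurable [set p : Om | D p.2].
Proof. by rewrite -[X in measurable X]setTI; exact: measurable_snd. Qed.

(** With finitely many environments, a preimage is a finite union of pieces, one per slice. The
    slices must themselves be generated by [K], which is how knowledge of E enters. *)
Lemma measurable_fun_joint d' (T : measurableType d') K (f : Om -> T)
    (g : env k -> Om -> T) :
  (forall e, <<s K >> [set p : Om | p.2 = e]) ->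
  (forall e, measurable_fun setT (g e : g_sigma_algebraType K -> T)) ->
  (forall p, f p = g p.2 p) ->
  measurable_fun setT (f : g_sigma_algebraType K -> T).
Proof.
move=> Ks mg fg _ A mA; rewrite setTI.
have -> : f @^-1` A = \bigcup_(e in setT) ([set p : Om | p.2 = e] `&` g e @^-1` A).
  apply/seteqP; split => [p Ap|p [e _ [/= <- Ap]]] /=; last by rewrite fg.
  by exists p.2 => //; split => //=; rewrite -fg.
apply: (@fin_bigcup_measurable _ (g_sigma_algebraType K)) => //.
move=> e _; apply: (@measurableI _ (g_sigma_algebraType K)); first exact: Ks.
by have := mg e measurableT A mA; rewrite setTI.
Qed.

Lemma measurable_joint_endo : measurable_fun setT joint_endo.
Proof.
move=> _ A mA; rewrite setTI.
have -> : joint_endo @^-1` A = \bigcup_(e in setT)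
    ([set p : Om | p.2 = e] `&` fst @^-1` (endo M e @^-1` A)).
  apply/seteqP; split => [p Ap|p [e _ [/= <- Ap]]] //=.
  by exists p.2.
apply: fin_bigcup_measurable.
  exact: finite_finset.
move=> e _; apply: measurableI; first exact: (measurable_env_slice [set e]).
rewrite -[X in measurable X]setTI; apply: measurable_fst => //.
by rewrite -[X in measurable X]setTI; exact: measurable_funP.
Qed.

Local Open Scope ereal_scope.

Lemma ge0_integral_joint (A : set Om) (f : Om -> \bar R) :
  measurable A -> (forall x, 0 <= f x) -> measurable_fun setT f ->
  \int[joint]_(x in A) f x =
  (k.+1%:R^-1)%:E * \sum_e \int[prob M]_(w in at_env e @^-1` A) f (w, e).
Proof.
move=> mA f0 mf; rewrite ge0_integral_mixture//; last exact: measurable_funTS.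
congr (_ * _); apply: eq_bigr => e _.
rewrite ge0_integral_pushforward//; exact: measurable_funTS.
Qed.

Lemma ge0_integral_law e (B : set (d.+1.-tuple R)) (f : d.+1.-tuple R -> \bar R) :
  measurable B -> (forall x, 0 <= f x) -> measurable_fun setT f ->
  \int[law M e]_(x in B) f x =
  \int[prob M]_(w in endo M e @^-1` B) f (endo M e w).
Proof.
by move=> mB f0 mf; rewrite ge0_integral_pushforward//; exact: measurable_funTS.
Qed.

Lemma integral_joint_mean_law (B : set (d.+1.-tuple R)) (f : d.+1.-tuple R -> \bar R) :
  measurable B -> (forall x, 0 <= f x) -> measurable_fun setT f ->
  \int[joint]_(p in joint_endo @^-1` B) f (joint_endo p) =
  \int[mean_law M]_(x in B) f x.
Proof.
move=> mB f0 mf; rewrite ge0_integral_joint//; last 2 first.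
- by rewrite -[X in measurable X]setTI; exact: measurable_joint_endo.
- by apply: measurableT_comp => //; exact: measurable_joint_endo.
rewrite ge0_integral_mixture//; last exact: measurable_funTS.
by congr (_ * _); apply: eq_bigr => e _; rewrite ge0_integral_law.
Qed.

Lemma integral_joint_law e (B : set (d.+1.-tuple R)) (f : d.+1.-tuple R -> \bar R) :
  measurable B -> (forall x, 0 <= f x) -> measurable_fun setT f ->
  \int[joint]_(p in [set p | p.2 = e] `&` joint_endo @^-1` B) f (joint_endo p) =
  (k.+1%:R^-1)%:E * \int[law M e]_(x in B) f x.
Proof.
move=> mB f0 mf; rewrite ge0_integral_joint//; last 2 first.
- apply: measurableI; first exact: (measurable_env_slice [set e]).
  by rewrite -[X in measurable X]setTI; exact: measurable_joint_endo.
- by apply: measurableT_comp => //; exact: measurable_joint_endo.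
congr (_ * _); rewrite (bigD1 e)//= big1 ?adde0 => [|e' /eqP e'e].
  rewrite ge0_integral_law//; congr integral.
  by apply/seteqP; split => w /=; [case|].
rewrite (_ : _ @^-1` _ = set0) ?integral_set0//.
by apply/seteqP; split => w //= [].
Qed.

End joint.

(** * Noise cylinders and their independence *)

Section noise.
Context (R : realType) (d k : nat) (M : menv_scm R d k).
Notation Om := (omega M * env k)%type.
Implicit Types (J : {set 'I_d.+1}).

Definition noise_cylinder J (A : forall j, set (exo_type M j)) (D : set (env k)) :
  set Om := [set p | D p.2 /\ forall j, j \in J -> A j (exo M j p.1)].

Definition noise_events (Ds : set (set (env k))) J : set (set Om) :=
  [set F | exists A : forall j, set (exo_type M j), exists2 D, Ds D &
     (forall j, measurable (A j)) /\ F = noise_cylinder J A D].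

Lemma noise_cylinder_bigcap J (A : forall j, set (exo_type M j)) D :
  noise_cylinder J A D =
  [set p | D p.2] `&` fst @^-1` (\bigcap_(j in [set` J]) (exo M j @^-1` A j)).
Proof. by []. Qed.

Lemma measurable_exo_bigcap J (A : forall j, set (exo_type M j)) :
  (forall j, measurable (A j)) ->
  measurable (\bigcap_(j in [set` J]) (exo M j @^-1` A j)).
Proof.
move=> mA; apply: fin_bigcap_measurable; first exact: finite_finset.
by move=> j _; rewrite -[X in measurable X]setTI; exact: measurable_funP.
Qed.

Lemma noise_events_measurable Ds J : noise_events Ds J `<=` measurable.
Proof.
move=> _ [A [D _ [mA ->]]]; rewrite noise_cylinder_bigcap.
apply: measurableI; first exact: measurable_env_slice.
rewrite -[X in measurable X]setTI; apply: measurable_fst => //.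
exact: measurable_exo_bigcap.
Qed.

Lemma noise_events_setI Ds J : setI_closed Ds -> setI_closed (noise_events Ds J).
Proof.
move=> DsI _ _ [A [D DD [mA ->]]] [A' [D' DD' [mA' ->]]].
exists (fun j => A j `&` A' j); exists (D `&` D'); first exact: DsI.
split => [j|]; first exact: measurableI.
apply/seteqP; split => p /=; rewrite /noise_cylinder /=.
  by move=> [[pD pA] [pD' pA']]; split => // j jJ; split; [exact: pA|exact: pA'].
by move=> [[pD pD'] pA]; split; split => // j /pA[].
Qed.

Lemma noise_eventsT (Ds : set (set (env k))) J :
  Ds setT -> noise_events Ds J setT.
Proof.
move=> DT; exists (fun=> setT); exists setT => //; split => //.
by apply/seteqP; split.
Qed.

Local Open Scope ereal_scope.

Lemma joint_noise J (A : forall j, set (exo_type M j)) D :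
  (forall j, measurable (A j)) ->
  joint M (noise_cylinder J A D) =
  (k.+1%:R^-1)%:E * (\sum_(e : env k) (\1_D e)%:E) *
    \prod_(j in J) prob M (exo M j @^-1` A j).
Proof.
move=> mA; rewrite /joint /= /mixture -muleA ge0_sume_distrl//.
congr (_ * _); apply: eq_bigr => e _.
rewrite -exo_indep// indicE.
rewrite -[LHS]/(prob M (at_env e @^-1` noise_cylinder J A D)).
have [eD|eD] := boolP (e \in D).
  rewrite mul1e; congr (prob M _); apply/seteqP; split => w /=.
    by case.
  by split => //; move: eD; rewrite inE.
rewrite mul0e (_ : _ @^-1` _ = set0) ?measure0//.
by apply/seteqP; split => w //= [/= De]; move: eD; rewrite notin_setE.
Qed.

(** The intersection is a cylinder over the union of [J1] and [J2], and [joint_noise] factors all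
    three probabilities. Only [F] may speak about E. *)
Lemma joint_noise_indep Ds J1 J2 F G : [disjoint J1 & J2]%B ->
  noise_events Ds J1 F -> noise_events [set setT] J2 G ->
  joint M (F `&` G) = joint M F * joint M G.
Proof.
move=> J12 [A [D _ [mA ->]]] [A' [_ -> [mA' ->]]].
have disjJ j : j \in J2 -> (j \in J1) = false.
  by move=> jJ2; exact: (disjointFl J12 jJ2).
pose B j := if j \in J1 then A j else A' j.
have mB j : measurable (B j) by rewrite /B; case: ifP.
have -> : noise_cylinder J1 A D `&` noise_cylinder J2 A' setT =
    noise_cylinder (J1 :|: J2) B D.
  apply/seteqP; split => p; rewrite /noise_cylinder /B /=.
    move=> [[pD p1] [_ p2]]; split => // j; rewrite inE.
    case: ifP => [j1 _|_ /=]; [exact: p1|exact: p2].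
  move=> [pD p12]; split; split => // j jJ.
    by have := p12 j; rewrite inE jJ/=; exact.
  by have := p12 j; rewrite inE jJ orbT disjJ//; exact.
rewrite !joint_noise//.
have -> : \prod_(j in J1 :|: J2) prob M (exo M j @^-1` B j) =
    (\prod_(j in J1) prob M (exo M j @^-1` A j)) *
    (\prod_(j in J2) prob M (exo M j @^-1` A' j)).
  rewrite big_mkcond /= [X in _ = X * _]big_mkcond [X in _ = _ * X]big_mkcond /=.
  rewrite -big_split /=; apply: eq_bigr => j _; rewrite /B inE.
  have [j1|j1] /= := boolP (j \in J1); last by rewrite mul1e.
  by rewrite (disjointFr J12 j1) mule1.
have -> : \sum_(e : env k) (\1_[set: env k] e)%:E = k.+1%:R%:E :> \bar R.
  under eq_bigr do rewrite indicT.
  by rewrite sumEFin sumr_const [#|_|]card_ord.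
set a := \prod_(j in J1) _; set b := \prod_(j in J2) _.
rewrite [X in _ = _ * (X * _)]( _ : _ = 1) ?mul1e; last first.
  by rewrite -EFinM mulVf ?pnatr_eq0.
by rewrite !muleA.
Qed.

End noise.
Arguments noise_events {R d k} M Ds J.

(** * Events generated by nodes *)

Section messages.
Context (R : realType) (d k : nat) (M : menv_scm R d k).
Notation Om := (omega M * env k)%type.
Implicit Types (D : {set 'I_d.+1}).

Definition joint_node (j : 'I_d.+1) (p : Om) : R := tnth (joint_endo p) j.

(** Events about single nodes are enough as generators: they are only conditioned on, and the lemmas
    on [cindep] ask no closure under intersection of the history. *)
Definition node_events D : set (set Om) :=
  [set F | exists2 s, s \in D & exists2 B, measurable B & F = joint_node s @^-1` B].

Lemma measurable_joint_node j : measurable_fun setT (joint_node j).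
Proof.
apply: (measurableT_comp (f := (@tnth d.+1 R)^~ j)); first exact: measurable_tnth.
exact: measurable_joint_endo.
Qed.

Lemma node_events_measurable D : node_events D `<=` measurable.
Proof.
move=> _ [s _ [B mB ->]]; rewrite -[X in measurable X]setTI.
exact: measurable_joint_node.
Qed.

Lemma measurable_node_events D K j : node_events D `<=` K -> j \in D ->
  measurable_fun setT (joint_node j : g_sigma_algebraType K -> R).
Proof.
move=> DK jD _ B mB; rewrite setTI; apply: sub_sigma_algebra; apply: DK.
by exists j => //; exists B.
Qed.

Lemma node_eventsU D D' :
  node_events (D :|: D') = node_events D `|` node_events D'.
Proof.
apply/seteqP; split => F.
  by move=> [s]; rewrite inE => /orP[sD|sD] sF; [left|right]; exists s.
by move=> [[s sD sF]|[s sD sF]]; exists s => //; rewrite inE sD ?orbT.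
Qed.

Lemma node_events0 : node_events finset.set0 = set0.
Proof. by apply/seteqP; split => // F [s]; rewrite inE. Qed.

Lemma node_events_sub D K :
  (forall s, s \in D ->
    measurable_fun setT (joint_node s : g_sigma_algebraType K -> R)) ->
  node_events D `<=` <<s K >>.
Proof.
move=> mD _ [s sD [B mB ->]].
by have := mD s sD measurableT B mB; rewrite setTI.
Qed.

Lemma measurable_coords_joint K D :
  (forall i, i \in D ->
    measurable_fun setT (joint_node i : g_sigma_algebraType K -> R)) ->
  measurable_fun setT
    ((fun p => coords D (joint_endo p)) : g_sigma_algebraType K -> _).
Proof.
move=> mD; apply/measurable_fun_tnthP => i.
rewrite (_ : _ \o _ = joint_node (enum_val i)); last first.
  by apply/funext => p /=; rewrite tnth_mktuple.
exact: mD (enum_valP i).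
Qed.

Lemma measurable_exo_joint K Ds J j : noise_events M Ds J `<=` K -> Ds setT ->
  j \in J ->
  measurable_fun setT
    ((fun p => exo M j p.1) : g_sigma_algebraType K -> exo_type M j).
Proof.
move=> NK DT jJ _ B mB; rewrite setTI; apply: sub_sigma_algebra; apply: NK.
(* The family is [B] at [j] and everything elsewhere. The type of [A i] depends on [i], so [B] is
   transported along [j = i]; [eq_axiomK] removes the transport at [j] itself. *)
pose A i : set (exo_type M i) :=
  if pselect (j = i) is left e then ecast i (set (exo_type M i)) e B else setT.
have mA i : measurable (A i).
  by rewrite /A; case: pselect => // e; case: _ / e.
have AB p : A j (exo M j p) = B (exo M j p).
  by rewrite /A; case: pselect => // e; rewrite (eq_axiomK e).
exists A; exists setT => //; split => //.
apply/seteqP; split => p /=; rewrite /noise_cylinder /=.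
  move=> Bp; split => // i iJ; rewrite /A; case: pselect => // e.
  by case: _ / e.
by move=> [_ /(_ j jJ)]; rewrite AB.
Qed.

End messages.
Arguments node_events {R d k} M D.

(** * Revealing the blanket of Y *)

Section protocol.
Context (R : realType) (d k : nat) (M : menv_scm R d k).
Notation Om := (omega M * env k)%type.
Notation y := (@ynode d).

Lemma fstr_invariant e j : j \notin intervened M ->
  fstr M e j = fstr M ord0 j :> (_ -> _).
Proof.
rewrite inE negb_and negbK => /orP[/eqP ->|/asboolPn jI].
  exact: fstr_y.
by apply: contrapT => ne; apply: jI; exists e.
Qed.

Lemma joint_nodeE j (p : Om) :
  joint_node j p = fstr M p.2 j (coords (pa M j) (joint_endo p), exo M j p.1).
Proof. by rewrite /joint_node /joint_endo [LHS]endo_eq. Qed.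

Lemma measurable_structural K Ds J j e : noise_events M Ds J `<=` K -> Ds setT ->
  j \in J ->
  (forall i, i \in pa M j ->
    measurable_fun setT (joint_node i : g_sigma_algebraType K -> R)) ->
  measurable_fun setT
    ((fun p => fstr M e j (coords (pa M j) (joint_endo p), exo M j p.1)) :
      g_sigma_algebraType K -> R).
Proof.
move=> NK DT jJ mpa.
apply: (measurableT_comp (f := fstr M e j)); first exact: measurable_funP.
apply: measurable_fun_pair; first exact: measurable_coords_joint.
exact: measurable_exo_joint NK DT jJ.
Qed.

(** The equation is the same in every environment, so noise events without information on E
    suffice. *)
Lemma measurable_node_invariant K J j :
  noise_events M [set setT] J `<=` K -> j \in J -> j \notin intervened M ->
  (forall i, i \in pa M j ->
    measurable_fun setT (joint_node i : g_sigma_algebraType K -> R)) ->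
  measurable_fun setT (joint_node j : g_sigma_algebraType K -> R).
Proof.
move=> NK jJ jI mpa.
have := @measurable_structural K [set setT] J j ord0 NK erefl jJ mpa.
congr measurable_fun; apply/funext => p.
by rewrite joint_nodeE (fstr_invariant _ jI).
Qed.

(** The equation may change with the environment, so the events about E are included and the
    equation is chosen slice by slice. *)
Lemma measurable_node_env K J j :
  noise_events M setT J `<=` K -> j \in J ->
  (forall i, i \in pa M j ->
    measurable_fun setT (joint_node i : g_sigma_algebraType K -> R)) ->
  measurable_fun setT (joint_node j : g_sigma_algebraType K -> R).
Proof.
move=> NK jJ mpa.
apply: (measurable_fun_joint (g := fun e p =>
  fstr M e j (coords (pa M j) (joint_endo p), exo M j p.1))).
- move=> e; apply: sub_sigma_algebra; apply: NK.
  exists (fun=> setT); exists [set e] => //; split => //.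
  by apply/seteqP; split => p //= [].
- by move=> e; exact: measurable_structural NK I jJ mpa.
- exact: joint_nodeE.
Qed.

Lemma stable_childrenP j : j \in stable_children M ->
  y \in pa M j /\ j \notin intervened M.
Proof. by rewrite !inE => /and3P[]. Qed.

Lemma SstarP s : s \in Sstar M <->
  [\/ s \in pa M y, s \in stable_children M |
      s <> y /\ exists2 j, j \in stable_children M & s \in pa M j].
Proof.
rewrite /Sstar !finset.in_setU; split.
  move=> /orP[/orP[|]|]; [by constructor 1|by constructor 2|].
  move=> /finset.bigcupP[j jA]; rewrite inE inE => /andP[/eqP sy sj].
  by constructor 3; split => //; exists j.
case=> [->|->|[sy [j jA sj]]]; rewrite ?orbT//.
apply/orP; right; apply/finset.bigcupP; exists j => //.
by rewrite inE inE sj andbT; apply/eqP.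
Qed.

Lemma ynode_Sstar : y \notin Sstar M.
Proof.
have irr := @ancestor_irrefl _ _ (@pa_acyclic _ _ _ M).
apply/negP => /SstarP[ys|/stable_childrenP[ys _]|[]//].
  by apply: (irr y); exact: ancestor_pa.
by apply: (irr y); exact: ancestor_pa.
Qed.

(** The last condition says that every directed path from Y into [W] starts with a stable child of
    Y. For such [W], E[Y | X_W] will depend on X_(S_star) only. *)
Definition blanket_set (W : {set 'I_d.+1}) : Prop :=
  [/\ Sstar M \subset W, y \notin W &
      forall c w, c \in children (pa M) y -> w \in W ->
        c = w \/ ancestor (pa M) c w -> c \in stable_children M].

(** * The two noise sources given the revealed nodes *)

Section blanket.
Variable W : {set 'I_d.+1}.
Hypothesis hW : blanket_set W.

Let A := stable_children M.
Let S0 := Sstar M.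
Let rk := rank (pa M).
(** The two sources: [G2] is the noise of Y and of its stable children, [G1] all other noise
    together with E. [S0_ t] collects the nodes of S_star revealed before round [t]. *)
Let N2 : {set 'I_d.+1} := (y |: A)%SET.
Let N1 : {set 'I_d.+1} := (~: N2)%SET.
Let G1 := noise_events M setT N1.
Let G2 := noise_events M [set setT] N2.
Let S0_ t : {set 'I_d.+1} := [set s in S0 | (rk s < t)%N]%SET.
Let H_ t := node_events M (S0_ t).

Let relevant j := exists2 w, w \in W & j = w \/ ancestor (pa M) j w.

Let relevant_pa i j : i \in pa M j -> relevant j -> relevant i.
Proof.
move=> ij [w wW jw]; exists w => //; right; case: jw => [<-|jw].
  exact: ancestor_pa.
by apply: ancestor_comp jw; exact: ancestor_pa.
Qed.

Let rk_lt i j : i \in pa M j -> (rk i < rk j)%N.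
Proof. exact: rank_pa (@pa_acyclic _ _ _ M) _ _. Qed.

Let measurable_past K t i : H_ t `<=` K -> i \in S0 -> (rk i < t)%N ->
  measurable_fun setT (joint_node i : g_sigma_algebraType K -> R).
Proof.
move=> HK iS it; apply: (measurable_node_events (D := S0_ t)) => //.
by rewrite inE iS.
Qed.

(** Induction on the rank. A parent that is a stable child has been revealed; any other parent is
    again relevant and in [N1]. It cannot be Y, since then [j] would be a child of Y leading into
    [W], hence stable, against [j] in [N1]. *)
Let measurable_side1 t j : relevant j -> j \in N1 -> (rk j <= t)%N ->
  measurable_fun setT (joint_node j : g_sigma_algebraType (G1 `|` H_ t) -> R).
Proof.
have [r rj] := ubnP (rk j); elim: r j rj => // r IH j rj Tj jN jt.
apply: (measurable_node_env (J := N1)) => // i ij.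
have ri := rk_lt ij; have Ti := relevant_pa ij Tj.
have [iA|iA] := boolP (i \in A).
  apply: (@measurable_past _ t) => //; last exact: leq_trans jt.
  by apply/SstarP; constructor 2.
apply: IH => //.
- exact: leq_trans ri _.
- rewrite /N1 /N2 finset.in_setC finset.in_setU1 negb_or iA andbT.
  apply/eqP => iy.
  case: Tj => w wW jw; have [_ _ /(_ j w)] := hW.
  rewrite inE -iy => /(_ ij wW jw) jA.
  by move: jN; rewrite /N1 /N2 finset.in_setC finset.in_setU1 jA orbT.
- exact: leq_trans (ltnW ri) jt.
Qed.

(** The parents of Y, and those of a stable child other than Y, lie in S_star and have smaller rank,
    so they have been revealed. The equations involved do not change with E. *)
Let measurable_side2 t j : j \in N2 -> (rk j <= t)%N ->
  measurable_fun setT (joint_node j : g_sigma_algebraType (G2 `|` H_ t) -> R).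
Proof.
have my : (rk y <= t)%N ->
    measurable_fun setT (joint_node y : g_sigma_algebraType (G2 `|` H_ t) -> R).
  move=> yt; apply: (measurable_node_invariant (J := N2)) => //.
  - by rewrite !inE eqxx.
  - by rewrite inE eqxx.
  - move=> i iy; apply: (@measurable_past _ t) => //.
      by apply/SstarP; constructor 1.
    exact: leq_trans (rk_lt iy) yt.
move=> jN jt; have [jy|jy] := eqVneq j y; first by rewrite jy; apply: my; rewrite -jy.
have jA : j \in A.
  by move: jN; rewrite /N2 finset.in_setU1 (negPf jy).
have [yj jI] := stable_childrenP jA.
apply: (measurable_node_invariant (J := N2)) => // i ij.
have [->|/eqP iy] := eqVneq i y; first by apply: my; exact: leq_trans (ltnW (rk_lt yj)) jt.
apply: (@measurable_past _ t) => //; last exact: leq_trans (rk_lt ij) jt.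
by apply/SstarP; constructor 3; split => //; exists j.
Qed.

Let G1m : G1 `<=` measurable. Proof. exact: noise_events_measurable. Qed.
Let G2m : G2 `<=` measurable. Proof. exact: noise_events_measurable. Qed.
Let Hm D : node_events M D `<=` measurable.
Proof. exact: node_events_measurable. Qed.

(** Induction on [t]: before round 0 nothing is revealed and the sources are independent; each round
    is an instance of [cindep_step]. *)
Let cindep_past t : cindep (joint M) G1 G2 (H_ t).
Proof.
have G1I : setI_closed G1 by apply: noise_events_setI.
have G2I : setI_closed G2.
  by apply: noise_events_setI => _ _ -> ->; rewrite setTI.
have G1T : G1 setT by apply: noise_eventsT.
have G2T : G2 setT by apply: noise_eventsT.
elim: t => [|t IH].
  have -> : H_ 0 = set0.
    rewrite /H_ (_ : S0_ 0 = finset.set0) ?node_events0//.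
    by apply/setP => s; rewrite !inE ltn0 andbF.
  apply: cindep_indep => // F F' GF GF'.
  apply: (joint_noise_indep _ GF GF').
  by rewrite /N1 finset.disjoints_subset.
(* Round [t] reveals the nodes of rank [t]: [D1] is announced by the source [G1], [D2] by [G2]. *)
pose D1 := [set s in S0 | (rk s == t) && (s \notin A)]%SET.
pose D2 := [set s in S0 | (rk s == t) && (s \in A)]%SET.
have -> : H_ t.+1 = H_ t `|` node_events M D1 `|` node_events M D2.
  rewrite /H_ -!node_eventsU; congr (node_events M _); apply/setP => s.
  have memS t' : (s \in S0_ t') = (s \in S0) && (rk s < t')%N by rewrite finset.in_set.
  have memD1 : (s \in D1) = (s \in S0) && ((rk s == t) && (s \notin A)).
    by rewrite finset.in_set.
  have memD2 : (s \in D2) = (s \in S0) && ((rk s == t) && (s \in A)).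
    by rewrite finset.in_set.
  rewrite !finset.in_setU !memS memD1 memD2 ltnS leq_eqVlt.
  by case: (s \in S0) (rk s == t) (s \in A) => [] [] []; rewrite //= ?orbT ?orbF.
apply: cindep_step => //; [exact: Hm|apply: node_events_sub => s..].
- rewrite finset.in_set => /=/and3P[sS /eqP st sA]; apply: measurable_side1.
  + by case: hW => /fintype.subsetP SW _ _; exists s; [exact: SW|left].
  + rewrite /N1 /N2 finset.in_setC finset.in_setU1 negb_or sA andbT.
    by apply: contraTneq sS => ->; exact: ynode_Sstar.
  + by rewrite st.
- rewrite finset.in_set => /=/and3P[sS /eqP st sA]; apply: measurable_side2.
    by rewrite /N2 finset.in_setU1 sA orbT.
  by rewrite st.
Qed.

Let H_last : H_ d.+2 = node_events M S0.
Proof.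
congr (node_events M _); apply/setP => s.
by rewrite finset.in_set rank_lt andbT.
Qed.

Local Open Scope ereal_scope.

(** Given X_(S_star), the source [G1] brings no news about Y, so the pooled version [g] stays one
    after conditioning on [G1] too. The event that E is [e] and X_W is in [B] is determined by [G1]
    and X_(S_star); integrating over it gives the claim in environment [e]. *)
Lemma cond_exp_blanket (f : R -> \bar R) (g : #|S0|.-tuple R -> \bar R) :
  (forall x, 0 <= f x) -> measurable_fun setT f ->
  (mean_law M).-integrable setT (fun z => f (tnth z y)) ->
  (forall x, 0 <= g x) -> measurable_fun setT g ->
  (mean_law M).-integrable setT (g \o coords S0) ->
  (forall B, measurable B ->
    \int[mean_law M]_(z in coords S0 @^-1` B) f (tnth z y) =
    \int[mean_law M]_(z in coords S0 @^-1` B) g (coords S0 z)) ->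
  forall e B, measurable B ->
    \int[law M e]_(z in coords W @^-1` B) f (tnth z y) =
    \int[law M e]_(z in coords W @^-1` B) g (coords S0 z).
Proof.
move=> f0 mf fi g0 mg gi fg e B mB.
have mpre (D : {set 'I_d.+1}) (C : set (#|D|.-tuple R)) : measurable C ->
    measurable (coords D @^-1` C : set (d.+1.-tuple R)).
  by move=> mC; rewrite -[X in measurable X]setTI; exact: measurable_funP.
have mfy : measurable_fun setT (fun z : d.+1.-tuple R => f (tnth z y)).
  by apply: measurableT_comp => //; exact: measurable_tnth.
have mgS : measurable_fun setT (g \o coords S0 : d.+1.-tuple R -> _).
  exact: measurableT_comp.
have jint (u : d.+1.-tuple R -> \bar R) : (forall x, 0 <= u x) ->
    (mean_law M).-integrable setT u ->
    (joint M).-integrable setT (fun p => u (joint_endo p)).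
  move=> u0 /integrableP[mu ui]; apply/integrableP; split.
    by apply: measurableT_comp => //; exact: measurable_joint_endo.
  have mau : measurable_fun setT (abse \o u) by exact: measurableT_comp.
  have au0 z : 0 <= (abse \o u) z by exact: abse_ge0.
  have := integral_joint_mean_law M measurableT au0 mau.
  by rewrite preimage_setT /= => ->.
pose F p := f (tnth (@joint_endo _ _ _ M p) y).
pose G p := g (coords S0 (@joint_endo _ _ _ M p)).
(* Events generated by the nodes of S_star are preimages under [coords S0], so [fg] transfers to the
   joint space. *)
have FG C : <<s node_events M S0 >> C ->
    \int[joint M]_(p in C) F p = \int[joint M]_(p in C) G p.
  move=> sC.
  pose cS := fun p => coords S0 (@joint_endo _ _ _ M p).
  have [C' mC' <-] : preimage_set_system setT cS measurable C.
    move: C sC; apply: smallest_sub.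
      by apply: sigma_algebra_preimage; exact: sigma_algebra_measurable.
    move=> _ [s sS [D mD ->]].
    exists ((@tnth _ R)^~ (enum_rank_in sS s) @^-1` D).
      by rewrite -[X in measurable X]setTI; exact: measurable_tnth.
    rewrite setTI; apply/seteqP; split => p /=;
      by rewrite /cS tnth_mktuple enum_rankK_in.
  rewrite setTI (_ : cS @^-1` C' = @joint_endo _ _ _ M @^-1` (coords S0 @^-1` C'))//.
  have mC := mpre _ _ mC'.
  rewrite (integral_joint_mean_law M mC _ mfy)// fg//.
  by rewrite (integral_joint_mean_law M mC (fun=> g0 _) mgS).
have mW (j : 'I_d.+1) : j \in W -> measurable_fun setT
    (joint_node j : g_sigma_algebraType (G1 `|` node_events M S0) -> R).
  move=> jW; have [jA|jA] := boolP (j \in A).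
    apply: (measurable_node_events (D := S0)) => //.
    by apply/SstarP; constructor 2.
  rewrite -H_last; apply: measurable_side1; last exact/ltnW/rank_lt.
    by exists j => //; left.
  rewrite /N1 /N2 finset.in_setC finset.in_setU1 negb_or jA andbT.
  by apply: contraTneq jW => ->; case: hW.
pose E : set Om := [set p | p.2 = e].
have sE : <<s G1 `|` node_events M S0 >> (E `&` @joint_endo _ _ _ M @^-1` (coords W @^-1` B)).
  apply: (@measurableI _ (g_sigma_algebraType (G1 `|` node_events M S0))).
    apply: sub_sigma_algebra; left.
    exists (fun=> setT); exists [set e] => //; split => //.
    by apply/seteqP; split => p //= [].
  by have := measurable_coords_joint mW measurableT mB; rewrite setTI.
have G1I : setI_closed G1 by apply: noise_events_setI.
have G1T : G1 setT by apply: noise_eventsT.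
have ci : cindep (joint M) G1 G2 (node_events M S0).
  by rewrite -H_last; exact: cindep_past.
have mF : measurable_fun setT
    (F : g_sigma_algebraType (G2 `|` node_events M S0) -> \bar R).
  apply: (measurableT_comp (f := f)) => //; rewrite -H_last.
  apply: measurable_side2; last exact/ltnW/rank_lt.
  by rewrite /N2 finset.in_setU1 eqxx.
have mG : measurable_fun setT (G : g_sigma_algebraType (node_events M S0) -> \bar R).
  apply: (measurableT_comp (f := g)) => //; apply: measurable_coords_joint => i iS.
  exact: measurable_node_events iS.
have := cindep_integral G1m G2m (@Hm _) G1I G1T ci (fun=> f0 _) (jint _ _ fi) mF
  (fun=> g0 _) (jint _ _ gi) mG FG sE.
rewrite (integral_joint_law M e (mpre _ _ mB) (fun=> f0 _) mfy)//.
rewrite (integral_joint_law M e (mpre _ _ mB) (fun=> g0 _) mgS)//.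
(* Multiplying by [k.+1] removes the probability of environment [e] from both sides. *)
move=> /(_ (fun=> f0 _) (fun=> g0 _))/(congr1 (fun u => k.+1%:R%:E * u)).
by rewrite !muleA -!EFinM mulfV ?pnatr_eq0// !mul1e.
Qed.

End blanket.
End protocol.

(** * Averaging the regressions *)

Section average.
Local Open Scope charge_scope.
Context d (T : measurableType d) (R : realType) (k : nat).
Variables (nu : env k -> probability T R) (nubar : probability T R).
Hypothesis nubarE : forall A,
  nubar A = ((k.+1%:R^-1)%:E * \sum_e nu e A)%E.

Let dens e := 'd (charge_of_finite_measure (nu e)) '/d nubar.

Lemma dominates_average e : charge_of_finite_measure (nu e) `<< nubar.
Proof.
apply/null_content_dominatesP => A mA nA.
have mixA : mixture nu A = 0%E by rewrite -[LHS]nubarE; exact: nA.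
by have /null_content_dominatesP := @dominates_mixture _ _ _ _ nu e; exact.
Qed.

Let dens_integral e A : measurable A ->
  (\int[nubar]_(x in A) dens e x = nu e A)%E.
Proof. by move=> mA; rewrite -(Radon_Nikodym_integral (dominates_average e) mA). Qed.

Let dens_integrable e : nubar.-integrable setT (dens e).
Proof. exact: (Radon_Nikodym_integrable (dominates_average e)). Qed.

Let dens_fin e x : dens e x \is a fin_num.
Proof. exact: (Radon_Nikodym_fin_num _ (dominates_average e)). Qed.

(** Over every measurable set [A], the average of the densities and the constant 1 both integrate to
    [nubar A]. *)
Lemma density_average_ae :
  {ae nubar, forall x, k.+1%:R^-1 * \sum_e fine (dens e x) = 1}.
Proof.
pose s x := (k.+1%:R^-1%:E * \sum_e dens e x)%E.
have si : nubar.-integrable setT s.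
  by apply: integrableZl => //; apply: integrable_sum => // e _; exact: dens_integrable.
have : ae_eq nubar setT s (cst 1%E).
  apply: integral_ae_eq => // A _ mA.
  have sAi : nubar.-integrable A (fun x => \sum_e dens e x)%E.
    apply: integrable_sum => // e _.
    exact: integrableS (dens_integrable e).
  rewrite integral_cst// mul1e integralZl// -[RHS]/(nubar A) nubarE.
  rewrite integral_sum//; last by move=> e; exact: integrableS (dens_integrable e).
  by congr (_ * _)%E; apply: eq_bigr => e _; exact: dens_integral.
apply: filterS => x /(_ I); rewrite /s /= => sx.
apply: EFin_inj; rewrite -[RHS]sx EFinM -sumEFin; congr (_ * _)%E.
by apply: eq_bigr => e _; rewrite fineK.
Qed.

Lemma density_null_ae e (N : set T) : measurable N -> nu e N = 0%E ->
  {ae nubar, forall x, N x -> dens e x = 0%E}.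
Proof.
move=> mN N0.
suff : ae_eq nubar N (dens e) (cst 0%E) by [].
apply: integral_ae_eq => //.
  exact: integrableS (dens_integrable e).
move=> A AN mA; rewrite dens_integral// integral_cst// mul0e.
by apply/eqP; rewrite eq_le measure_ge0 andbT -N0 le_measure ?inE.
Qed.

(** Where [m e] differs from [g], the density of [nu e] vanishes [nubar]-a.e.; so [g] factors out of
    the sum and the remaining weights average to 1. *)
Lemma density_mean_ae (m : env k -> T -> R) (g : T -> R) :
  (forall e, {ae nu e, forall x, m e x = g x}) ->
  {ae nubar, forall x, k.+1%:R^-1 * \sum_e fine (dens e x) * m e x = g x}.
Proof.
move=> mg.
have d0 e : {ae nubar, forall x, m e x = g x \/ dens e x = 0%E}.
  have [N [mN N0 mN']] := mg e.
  apply: filterS (density_null_ae mN N0) => x Nx.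
  have [|mx] := pselect (m e x = g x); first by left.
  by right; apply: Nx; exact: mN'.
have d0' : {ae nubar, forall x, forall e, m e x = g x \/ dens e x = 0%E}.
  exact: filter_forall.
apply: (filterS2 _ _ density_average_ae d0') => x s1 d0x.
rewrite (eq_bigr (fun e => fine (dens e x) * g x)); last first.
  by move=> e _; case: (d0x e) => ->//; rewrite !mul0r.
by rewrite -mulr_suml mulrA s1 mul1r.
Qed.

End average.

Section ae_map.
Context d d' (T : measurableType d) (T' : measurableType d') (R : realType).

Lemma ae_distribution (P : probability T R) (X : {mfun T >-> T'}) (Q : T' -> Prop) :
  {ae distribution P X, forall y, Q y} -> {ae P, forall x, Q (X x)}.
Proof.
move=> [N [mN N0 QN]]; exists (X @^-1` N); split => //.
  by rewrite -[X in measurable X]setTI; exact: measurable_funP.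
by move=> x; exact: QN.
Qed.

Lemma ae_dominates (P Q : probability T R) (A : T -> Prop) : P `<< Q ->
  {ae Q, forall x, A x} -> {ae P, forall x, A x}.
Proof.
move=> PQ [N [mN N0 AN]]; exists N; split => //.
by move/null_content_dominatesP : PQ; exact.
Qed.

End ae_map.

(** * Reading X_S off X_W *)

Section extension.
Context (R : realType) (n : nat).
Implicit Types (S W : {set 'I_n}).

(** A measurable section of [coords S], with default 0 outside [S]. It expresses X_S as a function
    of X_W for [S] inside [W]. *)
Definition extend S (x : #|S|.-tuple R) : n.-tuple R :=
  [tuple nth 0 x (index j (enum S)) | j < n].

Arguments extend : clear implicits.

Lemma index_enum_val S (i : 'I_#|S|) : index (enum_val i) (enum S) = i.
Proof. by rewrite {1}/enum_val index_uniq ?enum_uniq// -cardE. Qed.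

Lemma measurable_extend S : measurable_fun setT (extend S).
Proof.
apply/measurable_fun_tnthP => j.
have [jS|jS] := boolP (j \in S); last first.
  rewrite (_ : _ \o _ = cst 0); first exact: measurable_cst.
  apply/funext => x /=; rewrite tnth_mktuple nth_default// size_tuple.
  by rewrite memNindex ?mem_enum// cardE.
rewrite (_ : _ \o _ = (@tnth _ R)^~ (enum_rank_in jS j)); first exact: measurable_tnth.
apply/funext => x /=; rewrite tnth_mktuple (tnth_nth 0); congr nth.
by rewrite -[in LHS](enum_rankK_in jS jS) index_enum_val.
Qed.

Lemma coords_extend S W (z : n.-tuple R) : S \subset W ->
  coords S (extend W (coords W z)) = coords S z.
Proof.
move=> /fintype.subsetP SW; apply: eq_from_tnth => i; rewrite !tnth_mktuple.
set j := enum_val i; have jW : j \in W by apply: SW; exact: enum_valP.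
rewrite -[j in index j _](enum_rankK_in jW jW) index_enum_val.
by rewrite -tnth_nth tnth_mktuple enum_rankK_in.
Qed.

End extension.
Arguments extend {R n} S x.

(** * A regression function common to all environments *)

Section regression.
Context (R : realType) (d k : nat) (M : menv_scm R d k).
Variable m : env k -> forall S : {set 'I_d.+1}, #|S|.-tuple R -> R.
Arguments m : clear implicits.
Hypothesis hm : regression_versions M m.
Notation y := (@ynode d).
Local Open Scope ereal_scope.

Lemma integrable_mean_law (u : d.+1.-tuple R -> \bar R) :
  (mean_law M).-integrable setT u <->
  forall e, (law M e).-integrable setT u.
Proof.
split=> [/integrableP[mu iu] e|iu].
  apply/integrableP; split => //; move: iu.
  have mau : measurable_fun setT (abse \o u) by exact: measurableT_comp.
  rewrite ge0_integral_mixture// => iu; rewrite ltNge leye_eq; apply/negP => /eqP ey.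
  move: iu; rewrite (bigD1 e)//= ey addye; last first.
    by rewrite gt_eqF// (lt_le_trans (ltNyr 0))// sume_ge0// => i _; exact: integral_ge0.
  by rewrite gt0_muley ?ltxx// lte_fin invr_gt0 ltr0Sn.
have [mu _] := integrableP _ _ _ (iu ord0).
apply/integrableP; split => //.
have mau : measurable_fun setT (abse \o u) by exact: measurableT_comp.
rewrite ge0_integral_mixture//; apply: lte_mul_pinfty => //.
by apply: lte_sum_pinfty => e _; have /integrableP[] := iu e.
Qed.

(** The absolute value of Y is at most 1 + Y^2, which is integrable in each environment. *)
Lemma integrable_response : (mean_law M).-integrable setT
  (fun z => (tnth z y)%:E).
Proof.
have mY : measurable_fun setT (fun z : d.+1.-tuple R => (tnth z y)%:E).
  by apply/measurable_EFinP; exact: measurable_tnth.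
apply/integrable_mean_law => e; apply/integrableP; split => //.
have mY2 : measurable_fun setT (fun z : d.+1.-tuple R => (1 + `|tnth z y| ^+ 2)%:E).
  apply/measurable_EFinP; apply: measurable_funD => //.
  apply: measurable_funX; apply: measurableT_comp => //; exact: measurable_tnth.
apply: (@le_lt_trans _ _ (\int[law M e]_z (1 + `|tnth z y| ^+ 2)%:E)).
  apply: ge0_le_integral => //.
  - by apply: measurableT_comp.
  - move=> z _; rewrite lee_fin; set a := `|tnth z y|%R.
    have [a1|a1] := leP a 1%R; first by rewrite (le_trans a1)// lerDl sqr_ge0.
    apply: (@le_trans _ _ (a * a)%R); last by rewrite -expr2 lerDr.
    by apply: ler_peMl; [exact: normr_ge0|exact: ltW].
have := endo_y_L2 M e.
rewrite unlock => Y2.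
rewrite ge0_integral_law//.
rewrite preimage_setT.
under eq_integral do rewrite EFinD.
rewrite ge0_integralD//.
- apply: lte_add_pinfty => //; rewrite -[X in X < _]/(\int[prob M]_x cst 1 x).
  by rewrite integral_cst// mul1e -ge0_fin_numE//; exact: fin_num_measure.
- apply/measurable_EFinP; apply: measurable_funX; apply: measurableT_comp => //.
  apply: (measurableT_comp (f := (@tnth d.+1 R)^~ y)); first exact: measurable_tnth.
  exact: measurable_funP.
Qed.

(** [g] is the pooled conditional expectation of the positive part of Y given X_(S_star) minus that
    of the negative part; [cond_exp_blanket] carries both to X_W in each environment. One [g] serves
    every [W] and [e]. *)
Lemma common_regression : exists g : #|Sstar M|.-tuple R -> R,
  measurable_fun setT g /\
  forall W, blanket_set M W -> forall e,
    {ae distribution (law M e) (coords W),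
      forall x, m e W x = g (coords (Sstar M) (extend W x))}.
Proof.
set S0 := Sstar M.
pose Y (z : d.+1.-tuple R) := (tnth z y)%:E.
pose fp : R -> \bar R := (@EFin R)^\+; pose fn : R -> \bar R := (@EFin R)^\-.
have mE : measurable_fun setT (@EFin R) by exact/measurable_EFinP.
have fp0 x : 0 <= fp x by exact: funepos_ge0.
have fn0 x : 0 <= fn x by exact: funeneg_ge0.
have mfp : measurable_fun setT fp by exact: measurable_funepos.
have mfn : measurable_fun setT fn by exact: measurable_funeneg.
have Yi := integrable_response.
have YpE : Y^\+ = (fun z => fp (tnth z y)).
  by apply/funext => z; rewrite /fp !funeposE.
have YnE : Y^\- = (fun z => fn (tnth z y)).
  by apply/funext => z; rewrite /fn !funenegE.
have fpi : (mean_law M).-integrable setT (fun z => fp (tnth z y)).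
  by rewrite -YpE; exact: integrable_funepos.
have fni : (mean_law M).-integrable setT (fun z => fn (tnth z y)).
  by rewrite -YnE; exact: integrable_funeneg.
have mS : measurable_fun setT (coords S0 : d.+1.-tuple R -> _).
  exact: measurable_funP.
have [gp [gp0 gpf mgp gpi gpE]] := cond_exp_ex mS (fun z => fp0 (tnth z y)) fpi.
have [gn [gn0 gnf mgn gni gnE]] := cond_exp_ex mS (fun z => fn0 (tnth z y)) fni.
pose g x := (fine (gp x) - fine (gn x))%R.
have gE x : (g x)%:E = gp x - gn x by rewrite /g EFinB !fineK.
have mg : measurable_fun setT g.
  by apply: measurable_funB; exact: measurableT_comp.
exists g; split => // W hW e.
have [SW yW _] := hW.
have mW : measurable_fun setT (coords W : d.+1.-tuple R -> _).
  exact: measurable_funP.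
have [mm im mmE] := hm e yW.
pose u x := (m e W x)%:E; pose v x := (g (coords S0 (extend W x)))%:E.
have mu : measurable_fun setT u by exact/measurable_EFinP.
have mv : measurable_fun setT v.
  apply/measurable_EFinP; apply: measurableT_comp => //.
  by apply: measurableT_comp => //; exact: measurable_extend.
have vE z : v (coords W z) = gp (coords S0 z) - gn (coords S0 z).
  by rewrite /v coords_extend// gE.
have gpi' := (integrable_mean_law _).1 gpi e.
have gni' := (integrable_mean_law _).1 gni e.
have vi : (law M e).-integrable setT (v \o coords W).
  rewrite (_ : _ \o _ = (gp \o coords S0) \- (gn \o coords S0)).
    exact: integrableB.
  by apply/funext => z /=; rewrite vE.
(* Two functions of X_W agree a.e. once their integrals over the events of X_W do; here both give
   the integrals of Y. *)
suff : ae_eq (distribution (law M e) (coords W)) setT u v.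
  by apply: filterS => x /(_ I) [].
apply: integral_ae_eq => //.
  by apply: (integrable_pushforward mW) => //; rewrite preimage_setT.
move=> B _ mB; pose A : set (d.+1.-tuple R) := coords W @^-1` B.
have mA : measurable A by rewrite -[X in measurable X]setTI; exact: mW.
rewrite (integral_pushforward mW)//; last exact: integrableS im.
rewrite (integral_pushforward mW)//; last exact: integrableS vi.
rewrite [LHS](mmE B mB) [LHS]integralE.
have := cond_exp_blanket hW fp0 mfp fpi gp0 mgp gpi gpE e mB.
rewrite -YpE => ->.
have := cond_exp_blanket hW fn0 mfn fni gn0 mgn gni gnE e mB.
rewrite -YnE => ->.
rewrite -integralB//; last 2 first.
- exact: integrableS gpi'.
- exact: integrableS gni'.
by apply: eq_integral => z _; rewrite /= vE.
Qed.

End regression.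

Section mean.
Context (R : realType) (d k : nat) (M : menv_scm R d k).
Variable m : env k -> forall S : {set 'I_d.+1}, #|S|.-tuple R -> R.
Arguments m : clear implicits.
Hypothesis hm : regression_versions M m.

Lemma measurable_mean_regression (W : {set 'I_d.+1}) : ynode \notin W ->
  measurable_fun setT (mean_regression M m W).
Proof.
move=> yW; apply: measurable_funM => //; apply: measurable_sum => e.
have [mm _ _] := hm e yW.
apply: measurable_funM => //; apply: measurableT_comp => //.
apply: measurable_int; apply: Radon_Nikodym_integrable.
exact: (@dominates_average _ _ _ _ (fun e => distribution (law M e) (coords W))
  (distribution (mean_law M) (coords W)) (fun=> erefl)).
Qed.

Lemma mean_regression_ae (g : #|Sstar M|.-tuple R -> R) W : blanket_set M W ->
  (forall e, {ae distribution (law M e) (coords W),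
     forall x, m e W x = g (coords (Sstar M) (extend W x))}) ->
  {ae mean_law M, forall z,
    mean_regression M m W (coords W z) = g (coords (Sstar M) z)}.
Proof.
move=> [SW yW _] mg.
have := @density_mean_ae _ _ _ _ (fun e => distribution (law M e) (coords W))
  (distribution (mean_law M) (coords W)) (fun=> erefl) (fun e => m e W)
  (fun x => g (coords (Sstar M) (extend W x))) mg.
move=> /ae_distribution; apply: filterS => z.
by rewrite coords_extend.
Qed.

End mean.

(** * Children of Y, colliders and d-separation *)

Section graph_conditions.
Context (R : realType) (d k : nat) (M : menv_scm R d k).
Notation y := (@ynode d).
Notation anc := (ancestor (pa M)).

Lemma childrenP c : c \in children (pa M) y <-> y \in pa M c.
Proof. by rewrite inE. Qed.

Lemma stable_childrenE c : (c \in stable_children M) =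
  [&& c \in children (pa M) y, c \notin intervened M &
    [disjoint ancestors (pa M) c & children (pa M) y :&: intervened M]].
Proof. by rewrite [in LHS]finset.in_set. Qed.

Lemma stable_children_ancestor c j : c \in children (pa M) y -> anc c j ->
  j \in stable_children M -> c \in stable_children M.
Proof.
move=> cy cj; rewrite !stable_childrenE cy /= => /and3P[_ _ jI].
have anc_c : c \in ancestors (pa M) j by apply/ancestorsE.
apply/andP; split.
  apply/negP => cI; have := disjointFr jI anc_c.
  by rewrite finset.in_setI cy cI.
apply: disjointWl jI; apply/fintype.subsetP => i /ancestorsE ic.
by apply/ancestorsE; exact: ancestor_comp ic cj.
Qed.

(** The witness, [c] itself or an intervened child of Y above it, will be the collider between E and
    Y. *)
Lemma child_not_stable c : c \in children (pa M) y ->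
  c \notin stable_children M ->
  exists2 c', c' \in children (pa M) y :&: intervened M & c' = c \/ anc c' c.
Proof.
move=> cy; rewrite stable_childrenE cy /= negb_and negbK => /orP[cI|].
  by exists c; [rewrite finset.in_setI cy|left].
rewrite -setI_eq0 => /finset.set0Pn[c']; rewrite finset.in_setI => /andP[cc' c'I].
by exists c' => //; right; apply/ancestorsE.
Qed.

(** Only [S] needs checking. By acyclicity no child of Y leads to a parent of Y, and one that leads
    to a stable child, or to a parent of one, is stable by [stable_children_ancestor]. *)
Lemma blanket_Sstar_setU (S : {set 'I_d.+1}) : y \notin S ->
  (forall c w, c \in children (pa M) y -> w \in S ->
     c = w \/ anc c w -> c \in stable_children M) ->
  blanket_set M (S :|: Sstar M)%SET.
Proof.
move=> yS hS; split.
- exact: finset.subsetUr.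
- by rewrite finset.in_setU negb_or yS ynode_Sstar.
move=> c w cy; rewrite finset.in_setU => /orP[|wS]; first exact: hS.
move=> cw; have yc := (childrenP c).1 cy.
move/SstarP : wS => [wy|wA|[_ [j jA wj]]].
- exfalso; apply: (@ancestor_irrefl _ _ (@pa_acyclic _ _ _ M) y).
  apply: ancestor_comp (ancestor_pa yc) _.
  by case: cw => [->|cw]; [exact: ancestor_pa|exact: ancestor_trans wy cw].
- by case: cw => [->//|cw]; exact: stable_children_ancestor cw wA.
- apply: (stable_children_ancestor cy _ jA).
  by case: cw => [->|cw]; [exact: ancestor_pa|exact: ancestor_trans wj cw].
Qed.

Lemma blanket_Sstar : blanket_set M (Sstar M).
Proof.
have := @blanket_Sstar_setU finset.set0; rewrite finset.set0U; apply.
  by rewrite finset.in_set0.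
by move=> c w _; rewrite finset.in_set0.
Qed.

Lemma aug_node_inj : injective (@aug_node d).
Proof. exact: lift_inj. Qed.

Lemma aug_paE j : aug_pa M (aug_node j) =
  (aug_set (pa M j) :|: [set l | (l == enode d) && (j \in intervened M)])%SET.
Proof. by rewrite /aug_pa /aug_node liftK. Qed.

Lemma aug_node_pa i j : i \in pa M j -> aug_node i \in aug_pa M (aug_node j).
Proof.
by move=> ij; rewrite aug_paE finset.in_setU; apply/orP; left; exact: imset_f.
Qed.

Lemma aug_ancestor i j : anc i j ->
  ancestor (aug_pa M) (aug_node i) (aug_node j).
Proof.
elim=> {i j}[i j ij|i h j hj _ IH]; first exact/ancestor_pa/aug_node_pa.
exact: ancestor_trans (aug_node_pa hj) IH.
Qed.

Lemma enode_aug_node j : enode d != aug_node j.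
Proof. exact: neq_lift. Qed.

Lemma enode_aug_set (S : {set 'I_d.+1}) : enode d \notin aug_set S.
Proof.
by apply/imsetP => -[j _ ej]; have := enode_aug_node j; rewrite ej eqxx.
Qed.

(** The path from E through [c] to Y has the collider [c] as its only inner node, so [S] can block
    it only by avoiding [c] and its descendants. *)
Lemma dseparated_collider (S : {set 'I_d.+1}) c w :
  dseparated (aug_pa M) [set enode d]%SET [set aug_node y]%SET (aug_set S) ->
  c \in (children (pa M) y :&: intervened M)%SET -> w \in S ->
  ~ (c = w \/ anc c w).
Proof.
move=> dsep; rewrite finset.in_setI => /andP[/childrenP yc cI] wS cw.
have ec : enode d \in aug_pa M (aug_node c).
  by rewrite aug_paE finset.in_setU finset.in_set eqxx cI orbT.
have yac := aug_node_pa yc.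
have yneq : y != c.
  apply/eqP => yE; apply: (@ancestor_irrefl _ _ (@pa_acyclic _ _ _ M) y).
  by apply: ancestor_pa; rewrite {2}yE.
have [] := dsep (enode d) [:: aug_node c; aug_node y].
- by rewrite finset.in_set1.
- by rewrite /= finset.in_set1.
- by rewrite /= /linked /edge /= ec yac orbT.
- rewrite /= !in_cons !in_nil !orbF negb_or !enode_aug_node /= andbT.
  by rewrite (inj_eq aug_node_inj) eq_sym yneq.
case=> // _; rewrite /blocks /edge /= ec yac /= => /andP[cS dS].
case: cw => [cw|cw].
  by move/negP: cS; apply; rewrite cw; exact: imset_f.
have wd : aug_node w \in descendants (aug_pa M) (aug_node c).
  by rewrite finset.in_set; apply/ancestorsE; exact: aug_ancestor.
by have := disjointFr dS wd; rewrite imset_f.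
Qed.

End graph_conditions.

(** * From the blanket property to both claims *)

Theorem theorem3p1 (R : realType) (d k : nat) (M : menv_scm R d k)
    (m : env k -> forall S : {set 'I_d.+1}, #|S|.-tuple R -> R)
    (hm : regression_versions M m) :
  let S0 := Sstar M in
  let mstar := mean_regression M m S0 in
  (forall e : env k,
     {ae law M e, forall z, m e S0 (coords S0 z) = mstar (coords S0 z)}) /\
  (forall Z : {RV aug_prob M >-> (d.+2).-tuple R}, aug_solution Z ->
     aug_nondegenerate m Z -> aug_faithful Z ->
     forall S : {set 'I_d.+1}, ynode \notin S ->
       (0 < mean_law M [set z | mstar (coords S0 z) <>
              mean_regression M m (S :|: S0)%SET (coords (S :|: S0)%SET z)])%E ->
       heterogeneous M m S).
Proof.
move=> S0 mstar.
have [g [mg gE]] := common_regression hm.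
have gbar W (hW : blanket_set M W) := mean_regression_ae hW (gE W hW).
have hS0 := blanket_Sstar M.
split=> [e|Z _ nondeg faith S yS pos].
  have /ae_distribution me := gE _ hS0 e.
  (* The average equals [g] almost surely under the pooled law, hence under the dominated law of
     environment [e]. *)
  have mb := ae_dominates (@dominates_mixture _ _ _ _ (law M) e) (gbar _ hS0).
  apply: (filterS2 _ _ me mb) => z -> /=; rewrite /mstar => ->.
  by rewrite coords_extend.
apply: contrapT => nohet.
(* For a blanket set both averages equal the same [g] of X_(S_star) almost surely, so the set
   assumed to have positive measure is null. *)
suff hW : blanket_set M (S :|: S0)%SET.
  move: pos; set D := [set z | _]; suff -> : mean_law M D = 0%E by rewrite ltxx.
  have mD : measurable D.
    pose u z := mstar (coords S0 z) -
      mean_regression M m (S :|: S0)%SET (coords (S :|: S0)%SET z).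
    rewrite (_ : D = u @^-1` [set~ 0]).
      rewrite -[X in measurable X]setTI.
      have mu : measurable_fun setT u.
        apply: measurable_funB; apply: measurableT_comp => //;
          apply: measurable_mean_regression => //; [by case: hS0|by case: hW].
      by apply: mu => //; exact: measurableC.
    apply/seteqP; split => z /=; rewrite /D /u /=.
      by move=> ne /eqP; rewrite subr_eq0 => /eqP.
    by move=> ne e; apply: ne; rewrite e subrr.
  have [N [mN N0 DN]] : (mean_law M).-negligible D.
    have : {ae mean_law M, forall z, mstar (coords S0 z) =
        mean_regression M m (S :|: S0)%SET (coords (S :|: S0)%SET z)}.
      by apply: (filterS2 _ _ (gbar _ hS0) (gbar _ hW)) => z; rewrite /mstar => -> ->.
    by [].
  by apply/eqP; rewrite eq_le measure_ge0 andbT -N0 le_measure ?inE.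
apply: blanket_Sstar_setU => // c w cy wS cw.
(* A child of Y at or above a node of [S] makes that node a descendant of Y, so condition (a)
   applies to [S] and, without heterogeneity, yields conditional independence. *)
have yanc : ynode \in (\bigcup_(j in S) ancestors (pa M) j)%SET.
  apply/finset.bigcupP; exists w => //; apply/ancestorsE.
  have yc := ancestor_pa ((childrenP M c).1 cy).
  by case: cw => [<-//|]; exact: ancestor_comp.
have ci : cond_indep (aug_law Z) [set enode d]%SET [set aug_node ynode]%SET (aug_set S).
  by apply: contrapT => nci; apply: nohet; exact: nondeg yS yanc nci.
have dsep : dseparated (aug_pa M) [set enode d]%SET [set aug_node ynode]%SET (aug_set S).
  apply: faith ci.
  - by rewrite finset.disjoints1 finset.in_set1 enode_aug_node.
  - by rewrite finset.disjoints1 enode_aug_set.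
  - rewrite finset.disjoints1; apply/imsetP => -[j jS /aug_node_inj yj].
    by move/negP: yS; rewrite yj.
(* If [c] were not stable, an intervened child [c'] of Y at or above [c] would be a collider opened
   by [w]. *)
apply: contrapT => /negP cA.
have [c' c'I c'c] := child_not_stable cy cA.
apply: (dseparated_collider dsep c'I wS).
case: c'c cw => [-> //|c'c [<-|cw]]; right => //.
exact: ancestor_comp cw.
Qed.
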